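(* Let $K,K'$ be number fields, let $l> [K':\mathbb{Q}]$ be a prime number, and suppose that $\psi$ is an element of $\textup{Hom}_{L\textup{-series}}(\check{G}_{K}[l], \check{G}_{K'}[l])$. Then $\psi \in \textup{Hom}^\delta_{\mathcal{P}}(\check{G}_{K}[l], \check{G}_{K'}[l])$.
   Context: $\check{G}_{K}$ is the group of Dirichlet characters (continuous homomorphisms $G_K\to\mathbb{C}^\times$), $\check{G}_{K}[l]$ the subgroup generated by characters of order $l$; $\chi(\mathfrak p)=\chi(\mathrm{Frob}_{\mathfrak p})$ for unramified $\mathfrak p$, $0$ otherwise; $L_p(\chi,T)=\prod_{\mathfrak p\mid p}(1-\chi(\mathfrak p)T^{f_{\mathfrak p}})$, $f_{\mathfrak p}$ the inertia degree. $\textup{Hom}_{L\textup{-series}}(\check{G}_{K}[l], \check{G}_{K'}[l])$: group homomorphisms $\psi$ with $L_p(\chi,T)\mid L_p(\psi(\chi),T)$ for all rational primes $p$ and all $\chi$. $\textup{Hom}^\delta_{\mathcal{P}}(\check{G}_{K}[l], \check{G}_{K'}[l])$: group homomorphisms $\psi$ for which there exist a density-one set $\mathcal S$ inside the set $\mathcal P^{(1)}_K$ of unramified degree-one primes of $K$ and a map $\phi\colon\mathcal P^{(1)}_K\to\mathcal P_{K'}$ with $\mathfrak p\cap\mathbb{Z}=\phi(\mathfrak p)\cap\mathbb{Z}$ and $\psi(\chi)(\phi(\mathfrak p))=\chi(\mathfrak p)^{f_{\phi(\mathfrak p)}}$ for all $\mathfrak p\in\mathcal S$ and $\chi$ unramified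 at $\mathfrak p$. *)

(* Defs.v *)
From HB Require Import structures.
From mathcomp Require Import all_boot all_order all_algebra all_field.
From mathcomp Require Import ring_quotient complex.
From mathcomp Require Import all_classical all_reals all_analysis.

Set Implicit Arguments.
Unset Strict Implicit.
Unset Printing Implicit Defensive.

Import Order.TTheory GRing.Theory Num.Theory.
Import numFieldNormedType.Exports.

Local Open Scope classical_set_scope.
Local Open Scope ring_scope.

(* A number field is a [K : fieldExtType rat].  [algC] serves as an algebraic *)
(* closure of Q, and G_K is the automorphism group of [algC] over the image   *)
(* of an embedding [iota : {rmorphism K -> algC}].  Characters take values in *)
(* the complex numbers [R[i]], where [R : realType].                          *)

Definition integer_pred (L : fieldType) : pred L :=
  fun x => `[< integralOver (intr : int -> L) x >].
Arguments integer_pred L : clear implicits.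

Lemma integer_subring (L : fieldType) : subring_closed (integer_pred L).
Proof.
split=> [|x y /asboolP hx /asboolP hy|x y /asboolP hx /asboolP hy]; apply/asboolP.
- exact: (integral1 (intr : {rmorphism int -> L})).
- exact: (@integral_sub _ _ (intr : {rmorphism int -> L})).
- exact: (@integral_mul _ _ (intr : {rmorphism int -> L})).
Qed.

HB.instance Definition _ (L : fieldType) :=
  GRing.isSubringClosed.Build L (integer_pred L) (@integer_subring L).

(* For [L := algC] this is the ring of all algebraic integers. *)
Record integers (L : fieldType) : Type :=
  Integer { integer_val :> L; _ : integer_val \in integer_pred L }.

HB.instance Definition _ (L : fieldType) := [isSub for @integer_val L].
HB.instance Definition _ (L : fieldType) := [Choice of integers L by <:].
HB.instance Definition _ (L : fieldType) :=
  [SubChoice_isSubComNzRing of integers L by <:].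

Lemma integer_map_subproof (L M : fieldType) (f : {rmorphism L -> M}) (x : integers L) :
  f (val x) \in integer_pred M.
Proof.
apply/asboolP; have /asboolP [p pm pr] := valP x; exists p => //.
have -> : map_poly (intr : int -> M) p = map_poly f (map_poly (intr : int -> L) p).
  by rewrite -map_poly_comp; apply: eq_map_poly => n /=; rewrite rmorph_int.
exact: rmorph_root.
Qed.

Definition integer_map (L M : fieldType) (f : {rmorphism L -> M}) (x : integers L) : integers M :=
  Integer (integer_map_subproof f x).

Definition prime_ideal (A : comNzRingType) (I : {pred A}) : Prop :=
  idealr_closed I /\ prime_idealr_closed I.

Section Primes.
Variable K : fieldExtType rat.

Record primes_of : Type := PrimeOf {
  prime_pred : integers K -> bool;
  _ : `[< prime_ideal prime_pred /\ exists2 x, x \in prime_pred & x != 0 >] }.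

HB.instance Definition _ := [isSub for prime_pred].
HB.instance Definition _ := [Choice of primes_of by <:].

Canonical primes_of_predType := PredType prime_pred.

Implicit Type P : primes_of.

Definition primes_above (p : nat) : set primes_of := [set P : primes_of | p%:R \in P].

(* The rational prime below [P]. *)
Definition residue_char P : nat := xget 0 [set p : nat | prime p /\ p%:R \in P].

(* [b] reduces to a basis of the residue field over the prime field. *)
Definition residue_basis P (f : nat) (b : 'I_f -> integers K) : Prop :=
  forall x, exists! c : {ffun 'I_f -> 'I_(residue_char P)},
    x - \sum_i b i *+ c i \in P.

Definition inertia_degree P : nat :=
  xget 0 [set f : nat | exists b : 'I_f -> integers K, residue_basis P b].

Definition norm_of P : nat := (residue_char P ^ inertia_degree P)%N.

(* Membership in the ideal [P ^ e], generated by the products of [e] elements. *)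
Definition in_power P (e : nat) (x : integers K) : Prop :=
  exists (n : nat) (c : 'I_n -> integers K) (a : 'I_n -> 'I_e -> integers K),
    (forall i j, a i j \in P) /\ x = \sum_i c i * \prod_j a i j.

Definition is_ramification_index P (e : nat) : Prop :=
  in_power P e (residue_char P)%:R /\ ~ in_power P e.+1 (residue_char P)%:R.

Definition degree_one_primes : set primes_of :=
  [set P : primes_of | is_ramification_index P 1 /\ inertia_degree P = 1].

Definition prime_zeta (R : realType) (S : set primes_of) (s : R) : R :=
  fine (\esum_(P in S) ((norm_of P)%:R `^ (- s))%:E).

(* [S] has Dirichlet density [d] among all primes of [K]. *)
Definition has_density (R : realType) (S : set primes_of) (d : R) : Prop :=
  prime_zeta S s / prime_zeta setT s @[s --> (1 : R)^'+] --> d.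

End Primes.

Arguments degree_one_primes K : clear implicits.

Section AbsoluteGaloisGroup.
Variables (K : fieldExtType rat) (iota : {rmorphism K -> algC}).

Definition is_automorphism (s : algC -> algC) : Prop :=
  [/\ zmod_morphism s, monoid_morphism s, bijective s
    & forall x, s (iota x) = iota x].

Record absGal : Type := AbsGal {
  gal_fun :> algC -> algC; _ : `[< is_automorphism gal_fun >] }.

HB.instance Definition _ := [isSub for gal_fun].
HB.instance Definition _ := [Choice of absGal by <:].

Lemma gal_is_zmod_morphism (s : absGal) : zmod_morphism s.
Proof. by case: (asboolP _ (valP s)). Qed.
Lemma gal_is_monoid_morphism (s : absGal) : monoid_morphism s.
Proof. by case: (asboolP _ (valP s)). Qed.
Lemma gal_bij (s : absGal) : bijective s.
Proof. by case: (asboolP _ (valP s)). Qed.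
Lemma gal_fix (s : absGal) x : s (iota x) = iota x.
Proof. by case: (asboolP _ (valP s)). Qed.

HB.instance Definition _ (s : absGal) :=
  GRing.isZmodMorphism.Build algC algC s (gal_is_zmod_morphism s).
HB.instance Definition _ (s : absGal) :=
  GRing.isMonoidMorphism.Build algC algC s (gal_is_monoid_morphism s).

Definition gal_rmorphism (s : absGal) : {rmorphism algC -> algC} := s.

Lemma gal_one_subproof : is_automorphism idfun.
Proof. by split=> //; exists idfun. Qed.

Lemma gal_mul_subproof (s t : absGal) : is_automorphism (s \o t).
Proof.
split=> [x y|||x] /=.
- by rewrite !rmorphB.
- by split=> [|x y] /=; rewrite ?rmorph1 ?rmorphM.
- exact: bij_comp (gal_bij s) (gal_bij t).
- by rewrite !gal_fix.
Qed.

Lemma gal_inv_subproof (s : absGal) : is_automorphism (algC_invaut s).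
Proof.
split=> [|||x].
- exact: algC_invaut_is_zmod_morphism.
- exact: algC_invaut_is_monoid_morphism.
- by exists s; [exact: algC_invautK | exact: algC_autK].
- by rewrite -{1}(gal_fix s x) algC_autK.
Qed.

Definition gal_one : absGal := AbsGal (asboolT gal_one_subproof).
Definition gal_mul (s t : absGal) : absGal := AbsGal (asboolT (gal_mul_subproof s t)).
Definition gal_inv (s : absGal) : absGal := AbsGal (asboolT (gal_inv_subproof s)).

Lemma gal_mulA : associative gal_mul.
Proof. by move=> s t u; apply: val_inj. Qed.
Lemma gal_mul1s : left_id gal_one gal_mul.
Proof. by move=> s; apply: val_inj. Qed.
Lemma gal_muls1 : right_id gal_one gal_mul.
Proof. by move=> s; apply: val_inj. Qed.
Lemma gal_mulVs : left_inverse gal_one gal_inv gal_mul.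
Proof. by move=> s; apply/val_inj/funext => x /=; rewrite algC_autK. Qed.
Lemma gal_mulsV : right_inverse gal_one gal_inv gal_mul.
Proof. by move=> s; apply/val_inj/funext => x /=; rewrite algC_invautK. Qed.

HB.instance Definition _ := isGroup.Build absGal
  gal_mulA gal_mul1s gal_muls1 gal_mulVs gal_mulsV.

(* The Krull topology is the topology of pointwise convergence for the        *)
(* discrete topology on [algC].                                               *)
HB.instance Definition _ := Topological.copy absGal
  (initial_topology (gal_fun : absGal -> {ptws algC -> discrete_topology algC})).

Definition lies_over (Q : {pred integers algC}) (P : primes_of K) : Prop :=
  prime_ideal Q /\ forall x, (integer_map iota x \in Q) = (x \in P).

(* Both congruences imply that [s] stabilizes [Q]. *)
Definition in_inertia (Q : {pred integers algC}) (s : absGal) : Prop :=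
  forall x, integer_map (gal_rmorphism s) x - x \in Q.

Definition is_frobenius (P : primes_of K) (s : absGal) : Prop :=
  exists2 Q : {pred integers algC}, lies_over Q P &
    forall x, integer_map (gal_rmorphism s) x - x ^+ norm_of P \in Q.

(* A choice of Frobenius element: [Frob P] is only determined up to           *)
(* conjugation and inertia, which unramified characters do not see.           *)
Definition Frob (P : primes_of K) : absGal := xget 1%g [set s | is_frobenius P s].

Variable R : realType.

Definition is_dirichlet (chi : absGal -> R[i]) : Prop :=
  [/\ forall s, chi s != 0, forall s t, chi (s * t)%g = chi s * chi t
    & continuous (chi : absGal -> R[i]^o)].

Record dirichlet : Type := Dirichlet {
  char_fun :> absGal -> R[i]; _ : `[< is_dirichlet char_fun >] }.

HB.instance Definition _ := [isSub for char_fun].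
HB.instance Definition _ := [Choice of dirichlet by <:].

Lemma dirichletP (chi : dirichlet) : is_dirichlet chi.
Proof. exact/asboolP/(valP chi). Qed.

Lemma char_one_subproof : is_dirichlet (fun=> 1).
Proof.
split=> [s|s t|]; [exact: oner_neq0 | by rewrite mulr1 | exact: cst_continuous].
Qed.

Lemma char_mul_subproof (chi theta : dirichlet) :
  is_dirichlet (fun s => chi s * theta s).
Proof.
have [c0 cM cc] := dirichletP chi; have [t0 tM tc] := dirichletP theta.
split=> [s|s t|s]; first by rewrite mulf_neq0.
  by rewrite cM tM mulrACA.
exact: (@cvgM R[i] _ _ _ _ _ _ _ (cc s) (tc s)).
Qed.

Lemma char_inv_subproof (chi : dirichlet) : is_dirichlet (fun s => (chi s)^-1).
Proof.
have [c0 cM cc] := dirichletP chi; split=> [s|s t|s]; first by rewrite invr_eq0.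
  by rewrite cM invfM.
exact: (@cvgV R[i] _ _ _ _ _ (c0 s) (cc s)).
Qed.

Definition char_one : dirichlet := Dirichlet (asboolT char_one_subproof).
Definition char_mul (chi theta : dirichlet) : dirichlet :=
  Dirichlet (asboolT (char_mul_subproof chi theta)).
Definition char_inv (chi : dirichlet) : dirichlet :=
  Dirichlet (asboolT (char_inv_subproof chi)).

Lemma char_mulA : associative char_mul.
Proof. by move=> a b c; apply/val_inj/funext => s /=; rewrite mulrA. Qed.
Lemma char_mul1c : left_id char_one char_mul.
Proof. by move=> a; apply/val_inj/funext => s /=; rewrite mul1r. Qed.
Lemma char_mulc1 : right_id char_one char_mul.
Proof. by move=> a; apply/val_inj/funext => s /=; rewrite mulr1. Qed.
Lemma char_mulVc : left_inverse char_one char_inv char_mul.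
Proof.
move=> a; apply/val_inj/funext => s /=; rewrite mulVf //.
by case: (dirichletP a).
Qed.
Lemma char_mulcV : right_inverse char_one char_inv char_mul.
Proof.
move=> a; apply/val_inj/funext => s /=; rewrite mulfV //.
by case: (dirichletP a).
Qed.

HB.instance Definition _ := isGroup.Build dirichlet
  char_mulA char_mul1c char_mulc1 char_mulVc char_mulcV.

Definition unramified_at (chi : dirichlet) (P : primes_of K) : Prop :=
  forall Q s, lies_over Q P -> in_inertia Q s -> chi s = 1.

Definition char_at (chi : dirichlet) (P : primes_of K) : R[i] :=
  if `[< unramified_at chi P >] then chi (Frob P) else 0.

(* [\big[_/_]_(_ \in _)] would be 1 on an infinite support, but only finitely  *)
(* many primes lie above [p].                                                 *)
Definition local_factor (chi : dirichlet) (p : nat) : {poly R[i]} :=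
  \big[*%R/1]_(P \in primes_above p)
    (1 - char_at chi P *: 'X^(inertia_degree P)).

Definition has_order (G : groupType) (x : G) (l : nat) : Prop :=
  [/\ (0 < l)%N, (x ^+ l = 1)%g & forall m, (0 < m < l)%N -> (x ^+ m <> 1)%g].

Definition order_span (l : nat) : pred dirichlet := fun chi =>
  `[< forall H : {pred dirichlet}, group_closed H ->
      (forall theta, has_order theta l -> theta \in H) -> chi \in H >].

Lemma order_span_group (l : nat) : group_closed (order_span l).
Proof.
split=> [|a b /asboolP ha /asboolP hb]; apply/asboolP => H HG Hl.
  exact: HG.1.
by apply: HG.2; [apply: ha | apply: hb].
Qed.

Record dirichlet_gen (l : nat) : Type := DirichletGen {
  gen_char :> dirichlet; _ : gen_char \in order_span l }.

HB.instance Definition _ (l : nat) := [isSub for @gen_char l].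
HB.instance Definition _ (l : nat) := [Choice of dirichlet_gen l by <:].
HB.instance Definition _ (l : nat) :=
  SubChoice_isSubGroup.Build dirichlet (order_span l) (dirichlet_gen l)
    (order_span_group l).

End AbsoluteGaloisGroup.

Section Homomorphisms.
Variables (R : realType) (K K' : fieldExtType rat).
Variables (iota : {rmorphism K -> algC}) (iota' : {rmorphism K' -> algC}) (l : nat).
Variable psi : {multiplicative dirichlet_gen iota R l -> dirichlet_gen iota' R l}.

Definition hom_Lseries : Prop :=
  forall p, prime p -> forall chi : dirichlet_gen iota R l,
    local_factor chi p %| local_factor (psi chi) p.

Definition hom_primes_density : Prop :=
  exists (S : set (primes_of K)) (phi : degree_one_primes K -> primes_of K'),
    [/\ S `<=` degree_one_primes K, has_density S (1 : R) &
      forall P : degree_one_primes K, S (val P) ->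
        (forall n : int, n%:~R \in val P <-> n%:~R \in phi P) /\
        (forall chi : dirichlet_gen iota R l, unramified_at chi (val P) ->
          char_at (psi chi) (phi P) =
            char_at chi (val P) ^+ inertia_degree (phi P))].

End Homomorphisms.

(* Main.v *)
Require Import Defs.
From mathcomp Require Import all_boot all_order all_fingroup all_algebra all_field.
From mathcomp Require Import ring_quotient complex finmap.
From mathcomp Require Import all_classical all_reals all_analysis.
From mathcomp Require Import zify ring lra.

(* For a prime [P] of degree one over [p], divisibility of L-factors makes     *)
(* [1 / chi(P)] a root of the local factor of [psi chi] at [p], so that         *)
(* [psi(chi)(P') = chi(P)^f(P')] for some [P'] above [p], a priori depending on *)
(* [chi].  For fixed [P'] the characters with this property form a subgroup of  *)
(* the group of characters unramified at [P], which has exponent [l]; it is     *)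
(* covered by at most [K' : Q] < l such subgroups, hence equal to one of them.  *)
(* So every unramified prime of degree one works, and these have density one:   *)
(* the other primes contribute a bounded amount to the prime zeta function,     *)
(* which is unbounded near 1 since the sum of all [1 / N(P)] diverges.  If it   *)
(* converged, then among the elements [1 + M y], with [y] in a large box and    *)
(* [M] divisible by all small primes, few would lie in some prime: nonzero      *)
(* elements of [P] have norm at least [N(P)], so their coordinates are spread   *)
(* out.  The others are units, and these are rare in the box as well.           *)

Set Implicit Arguments.
Unset Strict Implicit.
Unset Printing Implicit Defensive.
Import Order.TTheory GRing.Theory Num.Theory.
Import numFieldNormedType.Exports.
Local Open Scope ring_scope.

(** * Prime ideals and integers *)

Section PrimeIdeal.
Variables (A : comNzRingType) (I : {pred A}).
Hypothesis I_prime : prime_ideal I.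

Lemma prime_ideal0 : 0 \in I. Proof. by case: I_prime => -[]. Qed.
Lemma prime_ideal1 : 1 \notin I. Proof. by case: I_prime => -[]. Qed.

Lemma prime_idealMr a x : x \in I -> a * x \in I.
Proof.
by case: I_prime => -[I0 _ IM] _ xI; rewrite -[a * x]addr0; exact: IM.
Qed.

Lemma prime_idealMl a x : x \in I -> x * a \in I.
Proof. by rewrite mulrC; exact: prime_idealMr. Qed.

Lemma prime_idealD x y : x \in I -> y \in I -> x + y \in I.
Proof.
by case: I_prime => -[I0 _ IM] _ xI yI; rewrite -[x]mul1r; exact: IM.
Qed.

Lemma prime_idealN x : x \in I -> - x \in I.
Proof. by move=> xI; rewrite -mulN1r; exact: prime_idealMr. Qed.

Lemma prime_idealB x y : x \in I -> y \in I -> x - y \in I.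
Proof. by move=> xI yI; apply/prime_idealD/prime_idealN. Qed.

Lemma prime_ideal_addr x y : x \in I -> (x + y \in I) = (y \in I).
Proof.
move=> xI; apply/idP/idP => [xyI|]; last exact: prime_idealD.
by rewrite -(addKr x y) addrC; exact: prime_idealB.
Qed.

Lemma prime_ideal_sum (T : Type) (r : seq T) (Q : pred T) (F : T -> A) :
  (forall i, Q i -> F i \in I) -> \sum_(i <- r | Q i) F i \in I.
Proof.
move=> FI; apply: (big_ind (fun x => x \in I)) => //.
  exact: prime_ideal0.
exact: prime_idealD.
Qed.

Lemma prime_ideal_mul x y : x * y \in I -> (x \in I) || (y \in I).
Proof. by case: I_prime => _; exact. Qed.

Lemma prime_ideal_exp x k : x ^+ k \in I -> x \in I.
Proof.
elim: k => [|k IHk]; first by rewrite expr0 (negPf prime_ideal1).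
by rewrite exprS => /prime_ideal_mul/orP[].
Qed.

Lemma prime_ideal_prod (T : eqType) (r : seq T) (Q : pred T) (F : T -> A) :
  \prod_(i <- r | Q i) F i \in I -> exists i, [/\ i \in r, Q i & F i \in I].
Proof.
elim: r => [|i r IHr]; first by rewrite big_nil (negPf prime_ideal1).
have ext : (exists j, [/\ j \in r, Q j & F j \in I]) ->
    exists j, [/\ j \in i :: r, Q j & F j \in I].
  by case=> j [jr Qj Fj]; exists j; rewrite inE jr orbT.
rewrite big_cons; case: ifP => [Qi|_ /IHr/ext//].
case/prime_ideal_mul/orP => [FiI|/IHr/ext//].
by exists i; rewrite mem_head.
Qed.

End PrimeIdeal.

Lemma integer_val_eq0 (L : fieldType) (x : integers L) : (val x == 0) = (x == 0).
Proof. by rewrite -(inj_eq val_inj). Qed.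

Lemma integer_mul_eq0 (L : fieldType) (x y : integers L) :
  (x * y == 0) = (x == 0) || (y == 0).
Proof. by rewrite -!integer_val_eq0 -mulf_eq0. Qed.

Lemma integer_dvd_int (L : fieldType) (x : integers L) : x != 0 ->
  exists (y : integers L) (m : int), m != 0 /\ x * y = m%:~R.
Proof.
move=> x0; have /asboolP[q q_mon qx0] := valP x.
have {qx0} : (map_poly (intr : int -> integers L) q).[x] = 0.
  apply: val_inj; rewrite -horner_map -map_poly_comp /= (_ : map_poly _ q = map_poly intr q).
    by apply/eqP; exact: qx0.
  by apply: eq_map_poly => m; exact: (rmorph_int (val : {rmorphism integers L -> L})).
have {q_mon} := monic_neq0 q_mon.
have [k] := ubnP (size q); elim: k q => // k IHk q; rewrite ltnS => szq q0.
have [q00|q00] := eqVneq q`_0 0.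
  have /factor_theorem[r qE] : root q 0 by rewrite rootE horner_coef0 q00.
  have {}qE : q = r * 'X by rewrite qE subr0.
  move: q0 szq; rewrite qE; have [->|r0 _] := eqVneq r 0; first by rewrite mul0r eqxx.
  rewrite size_mulX // => szr; rewrite rmorphM /= map_polyX hornerMX => /eqP.
  by rewrite integer_mul_eq0 (negPf x0) orbF => /eqP; exact: IHk.
elim/poly_ind: q {IHk szq} q0 q00 => [/eqP//|q c _ _].
rewrite -horner_coef0 hornerMXaddC mulr0 add0r => c0.
rewrite rmorphD rmorphM /= map_polyX map_polyC /= hornerMXaddC => qx.
exists (- (map_poly intr q).[x]), c; split=> //.
by rewrite mulrN mulrC; apply/eqP; rewrite eqr_oppLR -addr_eq0 qx.
Qed.

(** * Residue fields *)

Lemma extQ_intr_eq0 (K : fieldExtType rat) (m : int) : ((m%:~R : K) == 0) = (m == 0).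
Proof. by rewrite -(rmorph_int (in_alg K)) fmorph_eq0 intr_eq0. Qed.

Lemma integer_intr_eq0 (K : fieldExtType rat) (m : int) :
  ((m%:~R : integers K) == 0) = (m == 0).
Proof.
rewrite -integer_val_eq0 -(extQ_intr_eq0 K).
by rewrite (rmorph_int (val : {rmorphism integers K -> K})).
Qed.

Lemma integer_mulrI (K : fieldExtType rat) (m : int) (x y : integers K) :
  m != 0 -> m%:~R * x = m%:~R * y -> x = y.
Proof.
move=> m0 /eqP; rewrite -subr_eq0 -mulrBr integer_mul_eq0 integer_intr_eq0.
by rewrite (negPf m0) subr_eq0 => /eqP.
Qed.

Section PrimesOf.
Variable K : fieldExtType rat.
Implicit Types P Q : primes_of K.

Lemma primes_ofP P : prime_ideal (prime_pred P).
Proof. by case/asboolP: (valP P). Qed.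

Lemma primes_of_absz P (m : int) : (`|m|%N%:R \in P) = (m%:~R \in P).
Proof.
case: m => n //=; rewrite NegzE mulrNz /=; apply/idP/idP => nP.
  exact: (prime_idealN (primes_ofP P) nP).
by rewrite -[_%:R]opprK; exact: (prime_idealN (primes_ofP P) nP).
Qed.

Lemma prime_dvd_mem P n : (0 < n)%N -> n%:R \in P ->
  exists p, [/\ prime p, (p %| n)%N & p%:R \in P].
Proof.
have [k] := ubnP n; elim: k n => // k IHk n; rewrite ltnS => nk n0 nP.
have n1 : (1 < n)%N.
  rewrite ltn_neqAle n0 andbT; apply: contraTneq nP => <-.
  exact: (prime_ideal1 (primes_ofP P)).
have /(prime_ideal_mul (primes_ofP P))/orP[pP|dP] : (pdiv n)%:R * (n %/ pdiv n)%:R \in P.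
  by rewrite -natrM mulnC divnK ?pdiv_dvd.
  by exists (pdiv n); rewrite pdiv_prime ?pdiv_dvd.
have [|||p [p_pr pd pP]] // := IHk (n %/ pdiv n)%N.
- by rewrite (leq_trans _ nk) // ltn_Pdiv // prime_gt1 ?pdiv_prime.
- by rewrite divn_gt0 ?pdiv_gt0 // dvdn_leq ?pdiv_dvd.
by exists p; split=> //; apply: dvdn_trans pd _; apply: dvdn_div; exact: pdiv_dvd.
Qed.

Lemma residue_charP P : prime (residue_char P) /\ (residue_char P)%:R \in P.
Proof.
suff [p Pp] : exists p : nat, prime p /\ p%:R \in P.
  by rewrite /residue_char; case: xgetP => [y -> //|/(_ p)].
have /asboolP[PP [x xP /integer_dvd_int[y [m [m0 mE]]]]] := valP P.
have mP : m%:~R \in P by rewrite -mE; exact: (prime_idealMl PP).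
have [||p [p_pr _ pP]] := @prime_dvd_mem P `|m|%N; last by exists p.
  by rewrite absz_gt0.
by rewrite primes_of_absz.
Qed.

Lemma residue_char_prime P : prime (residue_char P).
Proof. by case: (residue_charP P). Qed.

Lemma mem_residue_char P : (residue_char P)%:R \in P.
Proof. by case: (residue_charP P). Qed.

Lemma primes_of_nat P n : (n%:R \in P) = (residue_char P %| n)%N.
Proof.
apply/idP/idP => [nP|/dvdnP[k ->]]; last first.
  by rewrite natrM; exact: (prime_idealMr (primes_ofP P) _ (mem_residue_char P)).
case: n nP => // n nP; apply: contraT; rewrite -prime_coprime ?residue_char_prime //.
rewrite coprime_sym => /eqP cop; case: (@egcdnP n.+1 (residue_char P)) => // a b ab _.
have := prime_idealMr (primes_ofP P) a%:R nP.
rewrite -natrM ab cop natrD natrM.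
rewrite (prime_ideal_addr (primes_ofP P)).
  by rewrite (negPf (prime_ideal1 (primes_ofP P))).
exact: (prime_idealMr (primes_ofP P) _ (mem_residue_char P)).
Qed.

Lemma primes_of_int P (m : int) : (m%:~R \in P) = (residue_char P %| m)%Z.
Proof. by rewrite -primes_of_absz primes_of_nat dvdzE. Qed.

Lemma primes_aboveE p P : prime p -> primes_above p P <-> residue_char P = p.
Proof.
move=> p_pr; rewrite /primes_above /= primes_of_nat; split=> [|->//].
by rewrite dvdn_prime2 ?residue_char_prime // => /eqP.
Qed.

Lemma int_lin_dependent f (x : 'I_f -> integers K) : (\dim {:K} < f)%N ->
  exists2 c : 'I_f -> int, \sum_i (c i)%:~R * x i = 0 &
    forall p, prime p -> exists i, ~~ (p %| c i)%Z.
Proof.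
move=> dimf; pose X := [tuple val (x i) | i < f].
have /freeP nfree : ~~ free X.
  apply: contraTN dimf; rewrite /free size_tuple -leqNgt => /eqP<-.
  exact/dimvS/subvf.
have [k [kX [i0 ki0]]] : exists k : 'I_f -> rat,
    \sum_(i < f) k i *: X`_i = 0 /\ exists i, k i != 0.
  apply: contrapT => noK; apply: nfree => k kX i; apply/eqP; apply: contraT => ki.
  by case: noK; exists k; split=> //; exists i.
pose r := \poly_(i < f) (if insub i is Some j then k j else 0).
have rE (i : 'I_f) : r`_i = k i by rewrite coef_poly ltn_ord valK.
have [q [a a0 rq]] := rat_poly_scale r.
have q0 : q != 0.
  apply: contraNneq ki0 => q0; rewrite -rE rq q0 rmorph0 scaler0 coef0 //.
exists (fun i => (zprimitive q)`_i); last first.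
  move=> p p_pr; apply/existsP; apply: contraT; rewrite negb_exists => /forallP pc.
  suff : (p %| zcontents (zprimitive q))%Z.
    by rewrite zcontents_primitive q0 dvdzE /= dvdn1 => /eqP p1; rewrite p1 in p_pr.
  rewrite dvdz_contents; apply/polyOverP => i.
  have [lif|lfi] := ltnP i f; first by have := pc (Ordinal lif); rewrite negbK.
  rewrite nth_default ?dvdz0 // size_zprimitive.
  rewrite (leq_trans _ lfi) // -(size_map_inj_poly (@intr_inj rat)) //.
  have a1 : (a%:~R^-1 : rat) != 0 by rewrite invr_eq0 intr_eq0.
  by rewrite -(size_scale _ a1) -rq size_poly.
pose d := zcontents q; have d0 : d != 0 by rewrite zcontents_eq0.
apply: (integer_mulrI d0); rewrite mulr0 mulr_sumr.
rewrite (eq_bigr (fun i : 'I_f => (q`_i)%:~R * x i)); last first.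
  by move=> i _; rewrite mulrA -intrM {2}(zpolyEprim q) coefZ.
apply/eqP; rewrite -integer_val_eq0 (rmorph_sum (val : {rmorphism integers K -> K})); apply/eqP.
transitivity (a%:~R *: (\sum_(i < f) k i *: X`_i)); last by rewrite kX scaler0.
rewrite scaler_sumr; apply: eq_bigr => i _.
rewrite (rmorphM (val : {rmorphism integers K -> K})) (rmorph_int (val : {rmorphism integers K -> K})).
rewrite -(tnth_nth 0) tnth_mktuple scalerA -rE rq coefZ coef_map /= mulrA.
by rewrite mulfV ?intr_eq0 // mul1r -mulr_algl -(rmorph_int (in_alg K)).
Qed.

End PrimesOf.

Section ResidueField.
Variable K : fieldExtType rat.
Implicit Types P Q : primes_of K.

Definition residue_free P f (b : 'I_f -> integers K) : Prop :=
  forall c : 'I_f -> int, \sum_i (c i)%:~R * b i \in P ->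
    forall i, (residue_char P %| c i)%Z.

Lemma residue_free_leq P f (b : 'I_f -> integers K) :
  residue_free P b -> (f <= \dim {:K})%N.
Proof.
move=> free_b; rewrite leqNgt; apply/negP => /(int_lin_dependent b)[c c0].
case/(_ _ (residue_char_prime P)) => i /negP; apply; apply: free_b.
by rewrite c0; exact: (prime_ideal0 (primes_ofP P)).
Qed.

Lemma residue_reduce P f (b : 'I_f -> integers K) (c : 'I_f -> int) :
  exists d : {ffun 'I_f -> 'I_(residue_char P)},
    (forall i, (d i)%:Z = (c i %% residue_char P)%Z) /\
    \sum_i (c i)%:~R * b i - \sum_i b i *+ d i \in P.
Proof.
set p := residue_char P; have p_pr : prime p := residue_char_prime P.
have p0 : p%:Z != 0 by rewrite eqz_nat -lt0n prime_gt0.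
have modP i : (`|(c i %% p)%Z| < p)%N.
  by rewrite -ltz_nat gez0_abs ?modz_ge0 // ltz_pmod // ltz_nat prime_gt0.
exists [ffun i => Ordinal (modP i)]; split=> [i|].
  by rewrite ffunE /= gez0_abs ?modz_ge0.
rewrite -sumrB; apply: (prime_ideal_sum (primes_ofP P)) => i _; rewrite ffunE /=.
rewrite -mulr_natl pmulrn gez0_abs ?modz_ge0 // -mulrBl -intrB {1}(divz_eq (c i) p) addrK.
apply: (prime_idealMl (primes_ofP P)); rewrite primes_of_int.
by rewrite dvdz_mull.
Qed.

Lemma residue_free_basis P f (b : 'I_f -> integers K) :
  residue_free P b -> (forall b' : 'I_f.+1 -> integers K, ~ residue_free P b') ->
  residue_basis P b.
Proof.
set p := residue_char P => free_b max_b x.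
have p_pr : prime p := residue_char_prime P.
have PP := primes_ofP P.
have [c xc] : exists c : 'I_f -> int, x - \sum_i (c i)%:~R * b i \in P.
  pose b' (i : 'I_f.+1) := if unlift ord0 i is Some j then b j else x.
  have /existsNP[c /existsNP[]] := max_b b'.
  rewrite big_ord_recl {1}/b' unlift_none.
  under eq_bigr => i _ do rewrite /b' liftK.
  move=> cP /existsNP[i0 /negP ci0].
  have pc0 : ~~ (p %| c ord0)%Z.
    apply: contra ci0 => pc0; have c0P : (c ord0)%:~R * x \in P.
      by apply: (prime_idealMl PP); rewrite primes_of_int.
    case: (unliftP ord0 i0) => [j ->|->//]; move: cP.
    by rewrite (prime_ideal_addr PP) // => /free_b.
  have cop : coprimez (c ord0) p.
    by rewrite coprimezE /= coprime_sym prime_coprime // -dvdzE.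
  have [u [v uv]] : exists u, exists v, u * c ord0 + v * p%:Z = 1 :> int.
    by case: (Bezoutz (c ord0) p%:Z) => u [v uv]; exists u, v; rewrite uv; apply/eqP.
  exists (fun i => - (u * c (lift ord0 i))).
  have -> : x - \sum_i (- (u * c (lift ord0 i)))%:~R * b i =
     u%:~R * ((c ord0)%:~R * x + \sum_(i < f) (c (lift ord0 i))%:~R * b i)
     + (v%:~R * x) * p%:R.
    have {1}-> : x = (u * c ord0 + v * p%:Z)%:~R * x by rewrite uv mul1r.
    rewrite mulrDr intrD !intrM mulrDl -!addrA mulrA; congr (_ + _).
    rewrite addrC; congr (_ + _); last by rewrite mulrAC.
    rewrite mulr_sumr -sumrN; apply: eq_bigr => i _.
    by rewrite mulrNz mulNr opprK intrM mulrA.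
  apply: (prime_idealD PP); first exact: (prime_idealMr PP).
  exact: (prime_idealMr PP _ (mem_residue_char P)).
have [d0 [d0E d0P]] := residue_reduce P b c.
exists d0; split; first by rewrite -(subrKA (\sum_i (c i)%:~R * b i)); exact: (prime_idealD PP).
move=> d xd; apply/ffunP => i; apply/val_inj/eqP; rewrite -eqz_nat d0E.
have dcP : \sum_i (c i - (d i)%:Z)%:~R * b i \in P.
  have -> : \sum_i (c i - (d i)%:Z)%:~R * b i =
    (x - \sum_i b i *+ d i) - (x - \sum_i (c i)%:~R * b i).
    rewrite opprB addrC addrA subrK -sumrB; apply: eq_bigr => j _.
    by rewrite intrB mulrBl -[(_%:Z)%:~R]/(_%:R) mulr_natl.
  exact: (prime_idealB PP).
have := free_b _ dcP i; rewrite -eqz_mod_dvd => /eqP->.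
by rewrite modz_nat modn_small.
Qed.

Lemma residue_basis_free P f (b : 'I_f -> integers K) :
  residue_basis P b -> residue_free P b.
Proof.
move=> bP c cP i; have PP := primes_ofP P.
have p0 := prime_gt0 (residue_char_prime P).
have [d [dE dP]] := residue_reduce P b c; have [d' [_ d'U]] := bP 0.
have dd : d = [ffun=> Ordinal p0].
  rewrite -(d'U d); first apply: d'U.
    by rewrite big1 ?subr0 ?(prime_ideal0 PP) // => j _; rewrite ffunE mulr0n.
  by have := prime_idealB PP dP cP; rewrite addrAC subrr.
by have := dE i; rewrite dd ffunE => /esym/dvdz_mod0P.
Qed.

Lemma residue_basis_exists P : exists f, exists b : 'I_f -> integers K, residue_basis P b.
Proof.
pose ex f := `[< exists b : 'I_f -> integers K, residue_free P b >].
have ex0 : exists f, ex f.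
  by exists 0%N; apply/asboolP; exists (fun=> 0) => c _ [].
have exM f : ex f -> (f <= \dim {:K})%N.
  by case/asboolP => b; exact: residue_free_leq.
case: (ex_maxnP ex0 exM) => f /asboolP[b free_b] max_f; exists f, b.
apply: residue_free_basis => // b' free_b'.
suff /max_f : ex f.+1 by rewrite ltnn.
by apply/asboolP; exists b'.
Qed.

Lemma inertia_degreeP P : exists b : 'I_(inertia_degree P) -> integers K, residue_basis P b.
Proof.
have [f bP] := residue_basis_exists P.
by rewrite /inertia_degree; case: xgetP => [y ->//|/(_ f)].
Qed.

Lemma inertia_degree_gt0 P : (0 < inertia_degree P)%N.
Proof.
have [b bP] := inertia_degreeP P; rewrite lt0n; apply/negP => /eqP f0.
have [c [+ _]] := bP 1; rewrite big1 ?subr0; last by move=> i; have := ltn_ord i; rewrite [X in (_ < X)%N]f0.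
by rewrite (negPf (prime_ideal1 (primes_ofP P))).
Qed.

Lemma primes_of_inv P x : x \notin P -> exists y, x * y - 1 \in P.
Proof.
move=> xP; have PP := primes_ofP P.
have [b bP] := inertia_degreeP P; set f := inertia_degree P in b bP.
pose e (c : {ffun 'I_f -> 'I_(residue_char P)}) := \sum_i b i *+ c i.
have /choice[g gP] z : exists c, z - e c \in P by have [c []] := bP z; exists c.
have e_inj c d : e c - e d \in P -> c = d.
  move=> cd; have [c' [_ c'u]] := bP (e c); rewrite -(c'u d) // (c'u c) //.
  by rewrite -/(e c) subrr; exact: (prime_ideal0 PP).
have inj : injective (fun c => g (x * e c)).
  move=> c d cd; apply: e_inj.
  have /(prime_ideal_mul PP) : x * (e c - e d) \in P; last by rewrite (negPf xP).
  have -> : x * (e c - e d) =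
     (x * e c - e (g (x * e c))) - (x * e d - e (g (x * e d))) by rewrite cd; ring.
  by apply: (prime_idealB PP); exact: gP.
have [h _ hK] := injF_bij inj.
exists (e (h (g 1))); have -> : x * e (h (g 1)) - 1 =
  (x * e (h (g 1)) - e (g (x * e (h (g 1))))) - (1 - e (g 1)).
  by rewrite hK; ring.
by apply: (prime_idealB PP); exact: gP.
Qed.

Lemma primes_of_maximal P Q : {subset P <= Q} -> P = Q.
Proof.
move=> PQ; apply: val_inj; apply/funext => x; apply/idP/idP => [/PQ//|xQ].
apply: contraT => /primes_of_inv[y /PQ xyQ].
have := prime_idealB (primes_ofP Q) (prime_idealMl (primes_ofP Q) y xQ) xyQ.
by rewrite opprB addrC subrK (negPf (prime_ideal1 (primes_ofP Q))).
Qed.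

Lemma primes_of_neq P Q : P != Q -> exists2 x, x \in P & x \notin Q.
Proof.
move=> PQ; apply: contrapT => nex; case/eqP: PQ; apply: primes_of_maximal => x xP.
by apply: contraT => xQ; case: nex; exists x.
Qed.

Lemma size_primes_above p (s : seq (primes_of K)) : uniq s ->
  {in s, forall P, residue_char P = p} -> (size s <= \dim {:K})%N.
Proof.
case: s => // P0 s'; set s := P0 :: s' => s_uniq sp.
have p_pr : prime p by rewrite -(sp P0) ?mem_head // residue_char_prime.
have /choice[z zP] (PQ : primes_of K * primes_of K) :
    exists z, PQ.1 != PQ.2 -> z \in PQ.1 /\ z \notin PQ.2.
  have [|/primes_of_neq[x]] := eqVneq PQ.1 PQ.2; first by exists 0.
  by exists x.
pose x (i : 'I_(size s)) := \prod_(Q <- s | Q != nth P0 s i) z (Q, nth P0 s i).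
have xnot i : x i \notin nth P0 s i.
  apply/negP => /(prime_ideal_prod (primes_ofP _))[Q [_ Qi]].
  by have [_ /negPf->] := zP (Q, nth P0 s i) Qi.
have xin (i j : 'I_(size s)) : i != j -> x i \in nth P0 s j.
  move=> ij; have ji : nth P0 s j != nth P0 s i by rewrite nth_uniq // eq_sym.
  rewrite /x (big_rem (nth P0 s j)) ?mem_nth //= ji.
  apply: (prime_idealMl (primes_ofP _)).
  by have [] := zP (nth P0 s j, nth P0 s i) ji.
rewrite leqNgt; apply/negP => /(int_lin_dependent x)[c c0 /(_ _ p_pr)[i /negP]]; apply.
have Pp : residue_char (nth P0 s i) = p by rewrite sp // mem_nth.
have cx : (c i)%:~R * x i \in nth P0 s i.
  move: c0; rewrite (bigD1 i) //= => /eqP; rewrite addr_eq0 => /eqP->.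
  apply: (prime_idealN (primes_ofP _)); apply: (prime_ideal_sum (primes_ofP _)) => j ji.
  by apply: (prime_idealMr (primes_ofP _)); exact: xin.
case/(prime_ideal_mul (primes_ofP _))/orP: cx; last by rewrite (negPf (xnot i)).
by rewrite primes_of_int Pp.
Qed.

Lemma finite_primes_above p : prime p -> finite_set (primes_above p : set (primes_of K)).
Proof.
move=> p_pr; apply: contrapT => /(infinite_set_fset (\dim {:K}).+1)[X XP].
rewrite ltnNge => /negP; apply.
apply: (@size_primes_above p); first exact: fset_uniq.
by move=> P PX; apply/primes_aboveE => //; exact: XP.
Qed.

End ResidueField.

(** * A power basis up to finite index *)

Section PowerBasis.
Variable K : fieldExtType rat.

Definition int_eval (a : integers K) (q : {poly int}) : integers K :=
  (map_poly intr q).[a].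

Lemma int_evalD a p q : int_eval a (p + q) = int_eval a p + int_eval a q.
Proof. by rewrite /int_eval rmorphD hornerD. Qed.

Lemma int_evalM a p q : int_eval a (p * q) = int_eval a p * int_eval a q.
Proof. by rewrite /int_eval rmorphM hornerM. Qed.

Lemma int_evalC a (c : int) : int_eval a c%:P = c%:~R.
Proof. by rewrite /int_eval map_polyC hornerC. Qed.

Lemma int_evalX a : int_eval a 'X = a.
Proof. by rewrite /int_eval map_polyX hornerX. Qed.

Lemma val_int_eval a q :
  val (int_eval a q) = (map_poly (in_alg K) (map_poly intr q)).[val a].
Proof.
rewrite /int_eval -horner_map -!map_poly_comp; congr (_.[_]).
apply: eq_map_poly => m; apply: (@etrans _ _ (m%:~R : K)).
  exact: (rmorph_int (val : {rmorphism integers K -> K})).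
exact/esym/(rmorph_int (in_alg K)).
Qed.

(* The powers of [a] below [n] span a subring of finite index, and [f] is the *)
(* minimal polynomial of [a].                                                 *)
Record power_order (n : nat) (a : integers K) (f : {poly int}) : Prop := PowerOrder {
  power_order_gt0 : (0 < n)%N;
  power_order_monic : f \is monic;
  power_order_size : size f = n.+1;
  power_order_root : int_eval a f = 0;
  power_order_free : forall q : {poly int}, (size q <= n)%N -> int_eval a q = 0 -> q = 0;
  power_order_index : exists2 D : int, D != 0 & forall x, exists2 q : {poly int},
    (size q <= n)%N & D%:~R * x = int_eval a q;
  power_order_deriv : exists2 D : int, D != 0 & exists y, int_eval a f^`() * y = D%:~R
}.

Lemma rat_integral_multiple (q : {poly rat}) (x : K) : q \is monic ->
  (map_poly (in_alg K) q).[x] = 0 -> (1 < size q)%N ->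
  exists2 d : int, d != 0 & exists f : {poly int},
    [/\ f \is monic, size f = size q &
        (map_poly (in_alg K) (map_poly intr f)).[d%:~R * x] = 0].
Proof.
move=> q_mon qx q1; have [r [d d0 qr]] := rat_poly_scale q; exists d => //.
set n := (size q).-1.
have szq : size q = n.+1 by rewrite prednK // ltnW.
have n0 : (0 < n)%N by rewrite -ltnS -szq.
pose f : {poly int} := 'X^n + \poly_(i < n) (r`_i * d ^+ (n.-1 - i)).
have szf : size f = n.+1 by rewrite size_polyDl ?size_polyXn // ltnS size_poly.
exists f; split.
- by rewrite monicE lead_coefDl ?lead_coefXn // size_polyXn ltnS size_poly.
- by rewrite szf.
have dQ0 : (d%:~R : rat) != 0 by rewrite intr_eq0.
have fi i : (i < n.+1)%N -> (map_poly intr f)`_i * d%:~R ^+ i = d%:~R ^+ n * q`_i.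
  rewrite ltnS leq_eqVlt coef_map /= coefD coefXn coef_poly => /orP[/eqP->|ltin].
    rewrite eqxx ltnn addr0 mul1r; move: q_mon; rewrite monicE lead_coefE => /eqP.
    by rewrite -/n => ->; rewrite mulr1.
  rewrite ltn_eqF // add0r ltin qr coefZ coef_map /=.
  rewrite rmorphM rmorphXn /= -mulrA -exprD subnK; last by rewrite -ltnS prednK.
  by rewrite -{2}(prednK n0) exprSr -mulrA mulVKf // mulrC.
have szfq : (size (map_poly (in_alg K) (map_poly intr f)) <= n.+1)%N.
  by rewrite (leq_trans (size_poly _ _)) // (leq_trans (size_poly _ _)) // szf.
have szqq : (size (map_poly (in_alg K) q) <= n.+1)%N.
  by rewrite (leq_trans (size_poly _ _)) // szq.
rewrite (horner_coef_wide _ szfq).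
transitivity (in_alg K (d%:~R ^+ n) * (map_poly (in_alg K) q).[x]); last by rewrite qx mulr0.
rewrite (horner_coef_wide _ szqq) mulr_sumr; apply: eq_bigr => i _.
rewrite exprMn mulrA [in RHS]mulrA; congr (_ * _).
rewrite !(coef_map (in_alg K)) -[d%:~R](rmorph_int (in_alg K)) -rmorphXn -!rmorphM.
by rewrite fi.
Qed.

Lemma adjoin_scale (x : K) (c : rat) : c != 0 -> <<1; c *: x>>%VS = <<1; x>>%VS.
Proof.
move=> c0; apply/eqP; rewrite eqEsubv; apply/andP; split.
  by apply/(@FadjoinP _ _ 1%AS); rewrite sub1v rpredZ // (memv_adjoin 1%AS).
apply/(@FadjoinP _ _ 1%AS); rewrite sub1v; split=> //.
rewrite -[X in X \in _](scale1r x) -(mulVf c0) -scalerA rpredZ //.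
exact: (memv_adjoin 1%AS).
Qed.

(* A primitive element is scaled so that its minimal polynomial is integral.  *)
Lemma integral_primitive_element : exists (a : integers K) (f : {poly int}),
  [/\ f \is monic, size f = (\dim {:K}).+1,
      map_poly (in_alg K) (map_poly intr f) = minPoly 1 (val a)
    & <<1; val a>>%VS = {:K}%VS].
Proof.
have char0 : has_char0 K by move=> p; rewrite pchar_lalg pchar_num.
have sep : separable 1 {:K} by apply/separableP => y _; exact: pcharf0_separable.
set b := separable_generator 1 {:K}.
have bK : {:K}%VS = <<1; b>>%VS := eq_adjoin_separable_generator sep (sub1v _).
have degE x : <<1; x>>%VS = {:K}%VS -> size (minPoly 1 x) = (\dim {:K}).+1.
  by move=> xK; rewrite size_minPoly adjoin_degreeE xK dimv1 divn1.
have /polyOver1P[q qE] := minPolyOver 1 b.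
have szq : size q = (\dim {:K}).+1.
  by rewrite -(degE b) // qE size_map_poly.
have q_mon : q \is monic by rewrite -(map_monic (in_alg K)) -qE monic_minPoly.
have qb : (map_poly (in_alg K) q).[b] = 0 by rewrite -qE; apply/eqP/root_minPoly.
have q1 : (1 < size q)%N by rewrite szq ltnS adim_gt0.
have [d d0 [f [f_mon szf fdb]]] := rat_integral_multiple q_mon qb q1.
have intdb : d%:~R * b \in integer_pred K.
  apply/asboolP; exists f => //; apply/eqP; rewrite -[RHS]fdb -map_poly_comp; congr (_.[_]).
  by apply: eq_map_poly => m; exact/esym/(rmorph_int (in_alg K)).
pose a := Integer intdb; exists a, f.
have aK : <<1; val a>>%VS = {:K}%VS.
  have -> : val a = (d%:~R : rat) *: b by rewrite /= mulrzl scaler_int.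
  by rewrite adjoin_scale // intr_eq0.
split=> //; first by rewrite szf.
apply/esym/eqP; rewrite -eqp_monic ?monic_minPoly ?map_monic //.
rewrite -dvdp_size_eqp; first by rewrite degE // size_map_poly size_map_inj_poly ?szf ?szq //; exact: intr_inj.
- apply: minPoly_dvdp; last by apply/eqP; rewrite fdb.
  by apply/polyOver1P; exists (map_poly intr f).
- by rewrite monic_map.
Qed.


Section Index.
Variables (a : integers K) (f : {poly int}).
Let n := \dim {:K}.
Let fQ : {poly rat} := map_poly intr f.
Hypotheses (f_mon : f \is monic) (szf : size f = n.+1).
Hypothesis f_min : map_poly (in_alg K) fQ = minPoly 1 (val a).
Hypothesis aK : <<1; val a>>%VS = {:K}%VS.

Let degE : adjoin_degree 1 (val a) = n.
Proof. by rewrite adjoin_degreeE aK dimv1 divn1. Qed.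

Lemma rat_eval_free (r : {poly rat}) : (size r <= n)%N ->
  (map_poly (in_alg K) r).[val a] = 0 -> r = 0.
Proof.
move=> szr /eqP; rewrite -rootE (@root_small_adjoin_poly _ _ 1%AS).
- by rewrite map_poly_eq0 => /eqP.
- by apply/polyOver1P; exists r.
- by rewrite degE size_map_poly.
Qed.

Lemma rat_eval_onto (x : K) : exists2 r : {poly rat},
  (size r <= n)%N & (map_poly (in_alg K) r).[val a] = x.
Proof.
have /polyOver1P[r rE] := Fadjoin_polyOver 1 (val a) x.
exists r; first by rewrite -(size_map_poly (in_alg K)) -rE -degE size_Fadjoin_poly.
by rewrite -rE (@Fadjoin_poly_eq _ _ 1%AS) // aK memvf.
Qed.

Lemma fQ_root : (map_poly (in_alg K) fQ).[val a] = 0.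
Proof. by rewrite f_min; apply/eqP/(@root_minPoly _ _ 1%AS). Qed.

Lemma fQ_dvd (r : {poly rat}) : (map_poly (in_alg K) r).[val a] = 0 -> fQ %| r.
Proof.
move=> ra; rewrite -(dvdp_map (in_alg K)) f_min.
apply: (@minPoly_dvdp _ _ 1%AS); first by apply/polyOver1P; exists r.
exact/eqP.
Qed.

Lemma separable_fQ : separable_poly fQ.
Proof.
have char0 : has_char0 K by move=> p; rewrite pchar_lalg pchar_num.
by rewrite -(separable_map (in_alg K)) f_min; exact: (@pcharf0_separable _ _ 1%AS).
Qed.

Lemma fQ_rootsC : exists r : 'rV[integers algC]_n, injective (r 0) /\
  forall i, (map_poly ratr fQ).[val (r 0 i)] = 0 :> algC.
Proof.
pose fC : {poly algC} := map_poly ratr fQ.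
have fC_int : fC = map_poly intr f.
  by rewrite /fC -map_poly_comp; apply: eq_map_poly => m; exact: ratr_int.
have fC_mon : fC \is monic by rewrite fC_int monic_map.
have [rs] := closed_field_poly_normal fC; rewrite (monicP fC_mon) scale1r => fC_rs.
have szrs : size rs = n.
  apply: succn_inj; rewrite -(size_prod_XsubC rs id) -fC_rs -szf fC_int.
  by rewrite size_map_inj_poly //; exact: intr_inj.
have uniq_rs : uniq rs.
  by rewrite -separable_prod_XsubC -fC_rs separable_map separable_fQ.
have root_rs z : z \in rs -> root fC z by rewrite fC_rs root_prod_XsubC.
have int_rs z : z \in rs -> z \in integer_pred algC.
  by move=> /root_rs; rewrite fC_int => rz; apply/asboolP; exists f.
have /choice[g gE] (i : 'I_n) : exists z : integers algC, val z = rs`_i.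
  have irs : rs`_i \in rs by rewrite mem_nth // szrs.
  by exists (Integer (int_rs _ irs)).
exists (\row_i g i); split=> [i j|i]; rewrite !mxE.
  move/(congr1 val); rewrite !gE => /eqP; rewrite nth_uniq ?szrs // => /eqP.
  exact: val_inj.
by rewrite gE; apply/eqP/root_rs; rewrite mem_nth // szrs.
Qed.

Lemma integer_pred_Aint (x : algC) : x \in integer_pred algC -> x \in Aint.
Proof.
case/asboolP => p p_mon px; apply: root_monic_Aint px _ _; first exact: monic_map.
by apply/polyOverP => i; rewrite coef_map /= intr_int.
Qed.

(* Cramer's rule for the Vandermonde system [x_j = \sum_i c_i r_j^i] in the  *)
(* conjugates [x_j] of [x] and [r_j] of [a].                                  *)
Lemma integral_index : exists2 D : int, D != 0 & forall x : integers K,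
  exists2 q : {poly int}, (size q <= n)%N & D%:~R * x = int_eval a q.
Proof.
have [r [r_inj r_root]] := fQ_rootsC.
pose V := Vandermonde n r.
have detV : \det V != 0.
  rewrite det_Vandermonde; apply: (big_ind (fun x => x != 0)) => [|x y x0 y0|i _].
  - by rewrite -integer_val_eq0 oner_neq0.
  - by rewrite integer_mul_eq0 negb_or x0.
  apply: (big_ind (fun x => x != 0)) => [|x y x0 y0|j ij].
  - by rewrite -integer_val_eq0 oner_neq0.
  - by rewrite integer_mul_eq0 negb_or x0.
  by rewrite subr_eq0 (inj_eq r_inj) gt_eqF.
have [dV [D [D0 DE]]] := integer_dvd_int detV.
exists D => // x.
have [c szc cx] := rat_eval_onto (val x).
have /asboolP[g g_mon gx] := valP x.
have fgc : fQ %| (map_poly intr g) \Po c.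
  apply: fQ_dvd; rewrite map_comp_poly horner_comp cx -map_poly_comp.
  apply: etrans (eqP gx); congr (_.[_]); apply: eq_map_poly => m.
  exact: (rmorph_int (in_alg K)).
pose valC : {rmorphism integers algC -> algC} := val.
have /choice[u uE] (j : 'I_n) : exists z : integers algC,
    val z = (map_poly ratr c).[val (r 0 j)].
  have intc : (map_poly ratr c).[val (r 0 j)] \in integer_pred algC.
    apply/asboolP; exists g => //; have /dvdpP[h hE] := fgc.
    have := congr1 (fun p => (map_poly (ratr : rat -> algC) p).[val (r 0 j)]) hE.
    rewrite map_comp_poly horner_comp rmorphM hornerM r_root mulr0 -map_poly_comp => gc0.
    rewrite rootE -[X in _ == X]gc0; apply/eqP; congr (_.[_]); apply: eq_map_poly => m.
    exact/esym/ratr_int.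
  by exists (Integer intc).
pose U := \row_j u j.
have UV : map_mx valC U = (\row_i ratr c`_i) *m map_mx valC V.
  apply/rowP => j; rewrite !mxE; apply: etrans (uE j) _.
  rewrite (horner_coef_wide _ (_ : (_ <= n)%N)); last by rewrite size_map_poly.
  by apply: eq_bigr => i _; rewrite !mxE coef_map rmorphXn.
have Dc i : (i < n)%N -> D%:~R * c`_i \is a Num.int.
  move=> lin; pose i' := Ordinal lin.
  have : map_mx valC (U *m \adj V) 0 i' = ratr c`_i * valC (\det V).
    rewrite map_mxM UV -mulmxA map_mx_adj mul_mx_adj det_map_mx.
    by rewrite mul_mx_scalar !mxE mulrC.
  rewrite mxE => /(congr1 (fun z => z * valC dV)).
  rewrite -mulrA -(rmorphM valC (\det V)) DE (rmorph_int valC).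
  rewrite -(rmorphM valC) => UE.
  have : ratr (D%:~R * c`_i) \in Aint.
    by rewrite rmorphM /= ratr_int mulrC -UE; apply/integer_pred_Aint/valP.
  move/(Cint_rat_Aint (Crat_rat _)) => /intrP[m mE]; apply/intrP; exists m.
  by apply: (fmorph_inj (ratr : {rmorphism rat -> algC})); apply: etrans mE _; exact/esym/ratr_int.
pose q := \poly_(i < n) Num.floor (D%:~R * c`_i).
exists q; first exact: size_poly.
apply/eqP; rewrite -(inj_eq val_inj); apply/eqP.
rewrite val_int_eval (_ : map_poly intr q = D%:~R *: c).
  rewrite linearZ hornerZ cx.
  by rewrite (rmorphM (val : {rmorphism integers K -> K})) !rmorph_int.
apply/polyP => i; rewrite coef_map coef_poly coefZ.
have [lin|nin] := ltnP i n; first by apply: floorK; exact: Dc.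
by rewrite nth_default ?mulr0 // (leq_trans szc).
Qed.

End Index.

Lemma power_order_exists : exists n a f, power_order n a f.
Proof.
have [a [f [f_mon szf f_min aK]]] := integral_primitive_element.
have n0 : (0 < \dim {:K})%N by rewrite adim_gt0.
have free (q : {poly int}) : (size q <= \dim {:K})%N -> int_eval a q = 0 -> q = 0.
  move=> szq qa; have /(rat_eval_free aK) : (size (map_poly intr q : {poly rat}) <= \dim {:K})%N.
    by rewrite size_map_inj_poly //; exact: intr_inj.
  rewrite -val_int_eval qa => /(_ erefl)/eqP.
  by rewrite -(rmorph0 (map_poly intr)) (inj_eq (map_inj_poly (@intr_inj _) _)) // => /eqP.
exists (\dim {:K}), a, f; split=> //.
- by apply: val_inj; rewrite val_int_eval; exact: fQ_root f_min.
- exact: (integral_index f_mon szf f_min aK).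
have [|y [m [m0 ym]]] := @integer_dvd_int K (int_eval a f^`()); last by exists m => //; exists y.
apply: contraTneq f_mon => f'a; rewrite monicE lead_coefE szf /=.
have f'0 : f^`() = 0.
  by apply: (free _ _ f'a); rewrite -ltnS -szf lt_size_deriv // -size_poly_gt0 szf.
have /eqP : f^`()`_(\dim {:K}).-1 = 0 by rewrite f'0 coef0.
by rewrite coef_deriv prednK // mulrn_eq0 (gtn_eqF n0) => /eqP->.
Qed.

End PowerBasis.

(** * Multiplication matrices and norms *)

Section PrimeExistence.
Local Open Scope classical_set_scope.
Variable K : fieldExtType rat.

Lemma primes_of_exists (x : integers K) (q : nat) : (0 < q)%N ->
  (forall y z, x * y + q%:R * z != 1) ->
  exists P : primes_of K, x \in P /\ q%:R \in P.
Proof.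
move=> q0 nxq.
pose proper (X : set (integers K)) :=
  [/\ X x, X q%:R, ~ X 1 & forall c u v, X u -> X v -> X (c * u + v)].
pose I0 := [set z | exists u v, z = x * u + q%:R * v].
have I0_proper : proper I0.
  split.
  - by exists 1, 0; rewrite mulr1 mulr0 addr0.
  - by exists 0, 1; rewrite mulr1 mulr0 add0r.
  - by case=> u [v /eqP]; rewrite eq_sym (negPf (nxq u v)).
  move=> c _ _ [u [v ->]] [u' [v' ->]]; exists (c * u + u'), (c * v + v'); ring.
have [F Ftriv Ftot|M [M_proper M_max]] :=
    @Zorn_bigcup _ (fun X => X = set0 \/ proper X).
  have [F0|/existsNP[X /not_implyP[FX X0]]] :=
      pselect (forall X, F X -> X = set0).
    by left; rewrite -subset0 => z [X /F0->].
  have proper_nz Y z : F Y -> Y z -> proper Y.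
    by move=> /Ftriv[->//|//].
  have {X0}[z Xz] : exists z, X z by apply/set0P/eqP.
  have [Xx Xq X1 XM] := proper_nz _ _ FX Xz.
  right; split.
  - by exists X.
  - by exists X.
  - by case=> Y FY Y1; have [_ _ nY1 _] := proper_nz _ _ FY Y1; exact: nY1.
  move=> c u v [Y FY Yu] [Z FZ Zv].
  have [YZ|ZY] := Ftot _ _ FY FZ.
  - by exists Z => //; have [_ _ _ ZM] := proper_nz _ _ FZ Zv; apply: ZM => //; exact: YZ.
  - by exists Y => //; have [_ _ _ YM] := proper_nz _ _ FY Yu; apply: YM => //; exact: ZY.
have {M_proper}[Mx Mq M1 MM] : proper M.
  case: M_proper => // M0; exfalso; apply: (M_max I0); last by right.
  rewrite M0; rewrite properEneq; split; last exact: sub0set.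
  by case: I0_proper => I0x _ _ _; apply/eqP => E; rewrite -E in I0x.
have M0 : M 0 by have := MM (-1) x x Mx Mx; rewrite mulN1r addNr.
have M_prime u v : M (u * v) -> M u \/ M v.
  move=> Muv; have [Mu|nMu] := pselect (M u); [by left | right].
  pose N := [set z | exists c m, M m /\ z = c * u + m].
  apply: contrapT => nMv; apply: (M_max N).
    rewrite properEneq; split.
      apply/eqP => MN; apply: nMu; rewrite MN; exists 1, 0; split=> //.
      by rewrite mul1r addr0.
    by move=> m Mm; exists 0, m; rewrite mul0r add0r.
  right; split.
  - by exists 0, x; rewrite mul0r add0r.
  - by exists 0, q%:R; rewrite mul0r add0r.
  - move=> [c [m [Mm one]]]; apply: nMv.
    have -> : v = c * (u * v) + (v * m + 0) by rewrite -[LHS]mulr1 one; ring.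
    by apply: (MM) => //; exact: MM.
  move=> c _ _ [d [m [Mm ->]]] [d' [m' [Mm' ->]]].
  exists (c * d + d'), (c * m + m'); split; [exact: MM | ring].
pose I : integers K -> bool := fun z => `[< M z >].
have I_ok : `[< prime_ideal I /\ exists2 z, z \in I & z != 0 >].
  apply/asboolP; split; last first.
    exists q%:R; first exact/asboolP.
    by rewrite (integer_intr_eq0 K q) eqz_nat -lt0n.
  split; first split.
  - exact/asboolP.
  - exact/asboolP.
  - by move=> c u v /asboolP Mu /asboolP Mv; apply/asboolP/MM.
  by move=> u v /asboolP/M_prime[Mu|Mv]; apply/orP; [left|right]; apply/asboolP.
by exists (PrimeOf I_ok); split; apply/asboolP.
Qed.

End PrimeExistence.

Section MultiplicationMatrix.
Variables (K : fieldExtType rat) (n : nat) (a : integers K) (f : {poly int}).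
Hypothesis af : power_order n a f.
Implicit Types u v : 'rV[int]_n.

Definition lin_eval v : integers K := \sum_j (v 0 j)%:~R * a ^+ j.

Lemma lin_evalD u v : lin_eval (u + v) = lin_eval u + lin_eval v.
Proof. by rewrite -big_split; apply: eq_bigr => j _; rewrite !mxE intrD mulrDl. Qed.

Lemma lin_evalZ c v : lin_eval (c *: v) = c%:~R * lin_eval v.
Proof. by rewrite mulr_sumr; apply: eq_bigr => j _; rewrite !mxE intrM mulrA. Qed.

Lemma lin_evalB u v : lin_eval (u - v) = lin_eval u - lin_eval v.
Proof. by rewrite -scaleN1r lin_evalD lin_evalZ mulN1r. Qed.

Lemma lin_eval_poly (q : {poly int}) : (size q <= n)%N ->
  lin_eval (poly_rV q) = int_eval a q.
Proof.
move=> szq; rewrite /int_eval (@horner_coef_wide _ n) ?(leq_trans (size_poly _ _)) //.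
by apply: eq_bigr => j _; rewrite mxE coef_map.
Qed.

Lemma lin_eval_inj : injective lin_eval.
Proof.
move=> u v uv; apply/eqP; rewrite -subr_eq0; apply/eqP.
have := lin_eval_poly (size_poly _ _ : (size (rVpoly (u - v)) <= n)%N).
rewrite rVpolyK lin_evalB uv subrr => /esym.
move/(power_order_free af (size_poly _ _)) => /(congr1 (@poly_rV _ n)).
by rewrite rVpolyK linear0.
Qed.

Lemma int_eval_reduce (q : {poly int}) : int_eval a (Pdiv.Ring.rmodp q f) = int_eval a q.
Proof.
rewrite {2}(Pdiv.RingMonic.rdivp_eq (power_order_monic af) q).
by rewrite int_evalD int_evalM (power_order_root af) mulr0 add0r.
Qed.

Definition power_mx k : 'M[int]_n :=
  \matrix_(i < n) poly_rV (Pdiv.Ring.rmodp 'X^(i + k) f).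

Definition mul_mx v : 'M[int]_n := \sum_k v 0 k *: power_mx k.

Lemma size_reduce (q : {poly int}) : (size (Pdiv.Ring.rmodp q f) <= n)%N.
Proof.
by rewrite -ltnS -(power_order_size af) Pdiv.Ring.ltn_rmodpN0 // monic_neq0 // (power_order_monic af).
Qed.

Lemma power_mx0 : power_mx 0 = 1%:M.
Proof.
apply/row_matrixP => i; rewrite rowK addn0 row1.
rewrite Pdiv.Ring.rmodp_small; last by rewrite size_polyXn (power_order_size af) ltnS ltn_ord.
by apply/rowP => j; rewrite !mxE coefXn eqxx.
Qed.

Lemma lin_eval_sum (T : Type) (r : seq T) (F : T -> 'rV[int]_n) :
  lin_eval (\sum_(i <- r) F i) = \sum_(i <- r) lin_eval (F i).
Proof.
apply: (big_morph lin_eval lin_evalD).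
by rewrite /lin_eval big1 // => j _; rewrite mxE mul0r.
Qed.

Lemma lin_eval_mul u v : lin_eval (u *m mul_mx v) = lin_eval u * lin_eval v.
Proof.
rewrite mulmx_sumr lin_eval_sum mulr_sumr; apply: eq_bigr => k _.
rewrite -scalemxAr lin_evalZ mulrCA; congr (_ * _).
rewrite mulmx_sum_row lin_eval_sum mulr_suml; apply: eq_bigr => i _.
rewrite lin_evalZ rowK -mulrA; congr (_ * _).
by rewrite lin_eval_poly ?size_reduce // int_eval_reduce -exprD /int_eval map_polyXn hornerXn.
Qed.

End MultiplicationMatrix.

Lemma Fp_intr_eq0 p (m : int) : prime p -> ((m%:~R : 'F_p) == 0) = (p %| m)%Z.
Proof.
move=> p_pr; have pF : p \in [pchar 'F_p] by rewrite pchar_Fp.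
rewrite dvdzE /= (dvdn_pcharf pF); case: m => k //=.
by rewrite NegzE mulrNz oppr_eq0.
Qed.

Lemma map_intr_unitmx (F : fieldType) n (A : 'M[int]_n) :
  A \in unitmx -> map_mx (intr : int -> F) A \in unitmx.
Proof. by rewrite !unitmxE det_map_mx; exact: rmorph_unit. Qed.

(* In Smith normal form [A] is diagonal, and the invertible [W *m B] mod [p]  *)
(* forces at least [f] of its diagonal entries to vanish mod [p].             *)
Lemma dvdz_det_corank p n f (A : 'M[int]_n) (B : 'M[int]_(n, f)) (W : 'M[int]_(f, n))
    (D : int) : prime p -> ~~ (p %| D)%Z ->
  (forall i j, (p %| (A *m B) i j)%Z) ->
  (forall i j, (p %| (W *m B - D%:M) i j)%Z) -> ((p ^ f)%N %| \det A)%Z.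
Proof.
move=> p_pr pD AB WB; pose phi m' n' (X : 'M[int]_(m', n')) := map_mx (intr : int -> 'F_p) X.
have phi0 m' n' (X : 'M[int]_(m', n')) : (forall i j, (p %| X i j)%Z) -> phi _ _ X = 0.
  by move=> X0; apply/matrixP => i j; rewrite !mxE; apply/eqP; rewrite Fp_intr_eq0.
have rankB : \rank (phi _ _ B) = f.
  apply/eqP; rewrite eqn_leq rank_leq_col.
  have D0 : (D%:~R : 'F_p) != 0 by rewrite Fp_intr_eq0.
  have rankD : \rank (D%:~R%:M : 'M['F_p]_f) = f.
    by rewrite -scalemx1 mxrank_scale_nz // mxrank1.
  apply: leq_trans (eq_leq (esym rankD)) _.
  have := phi0 _ _ _ WB; rewrite /phi map_mxB map_mxM map_scalar_mx /= => /eqP.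
  by rewrite subr_eq0 => /eqP<-; exact: mxrankM_maxr.
have [L L_unit [R R_unit [d _ AE]]] := int_Smith_normal_form A.
pose Dg := diag_mx (\row_(i < n) d`_i).
have {}AE : A = L *m Dg *m R.
  by rewrite AE; congr (_ *m _ *m _); apply/matrixP => i j; rewrite !mxE.
pose C := phi _ _ (R *m B).
have rankC : \rank C = f.
  by rewrite /C /phi map_mxM eqmxMfull ?rankB // row_full_unit map_intr_unitmx.
have DgC : phi _ _ Dg *m C = 0.
  have := phi0 _ _ _ AB; rewrite AE -!mulmxA /phi map_mxM => /(congr1 (mulmx (invmx (phi _ _ L)))).
  by rewrite mulKmx ?map_intr_unitmx // mulmx0 map_mxM.
pose S := [set i : 'I_n | (p %| d`_i)%Z].
have C0 i : i \notin S -> row i C = 0.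
  rewrite inE => pdi; apply/rowP => j; rewrite [in RHS]mxE.
  have /matrixP/(_ i j) := DgC; rewrite /phi map_diag_mx mul_diag_mx !mxE => /eqP.
  by rewrite mulf_eq0 Fp_intr_eq0 // (negPf pdi) => /eqP.
have fS : (f <= #|S|)%N.
  rewrite -rankC (leq_trans _ (rank_leq_row (rowsub (enum_val : 'I_#|S| -> 'I_n) C))) //.
  apply: mxrankS; apply/row_subP => i; have [iS|/C0->] := boolP (i \in S); last exact: sub0mx.
  rewrite -(enum_rankK_in iS iS) -[X in (X <= _)%MS](row_rowsub _ C).
  exact: row_sub.
rewrite AE !det_mulmx det_diag; apply: dvdz_mulr; apply: dvdz_mull.
rewrite (bigID [in S]) /=; apply: dvdz_mulr.
apply: (@dvdz_trans ((p ^ #|S|)%N : int)); first by rewrite dvdzE /= dvdn_exp2l.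
rewrite -prod_nat_const (big_morph Posz PoszM (erefl _)).
apply: (big_ind2 (fun x y => (x %| y)%Z)) => [|x y u v|i]; first exact: dvdz1.
  exact: dvdz_mul.
by rewrite inE mxE.
Qed.

Section PrimeNorms.
Variables (K : fieldExtType rat) (n : nat) (a : integers K) (f : {poly int}).
Hypothesis af : power_order n a f.
Variable D : int.
Hypothesis D_index : forall x, exists2 q : {poly int},
  (size q <= n)%N & D%:~R * x = int_eval a q.
Implicit Types (P : primes_of K) (v : 'rV[int]_n).

Lemma lin_eval_index x : exists v, D%:~R * x = lin_eval a v.
Proof.
have [q szq ->] := D_index x; exists (poly_rV q).
by rewrite lin_eval_poly.
Qed.

Lemma norm_dvd_det P v : ~~ (residue_char P %| D)%Z -> lin_eval a v \in P ->
  (norm_of P %| \det (mul_mx f v))%Z.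
Proof.
move=> pD vP; have PP := primes_ofP P; rewrite /norm_of.
have [b bP] := inertia_degreeP P; have b_free := residue_basis_free bP.
set e := inertia_degree P in b bP b_free *.
have /choice[c cP] x : exists c : 'I_e -> int, x - \sum_i (c i)%:~R * b i \in P.
  have [c [cx _]] := bP x; exists (fun i => (c i)%:Z).
  by under eq_bigr => i _ do rewrite -[(_%:Z)%:~R]/(_%:R) mulr_natl.
have /choice[w wP] j := lin_eval_index (b j).
pose B : 'M[int]_(n, e) := \matrix_(i, j) c (a ^+ i) j.
pose W : 'M[int]_(e, n) := \matrix_i w i.
have BE (u : 'rV_n) : lin_eval a u - \sum_j ((u *m B) 0 j)%:~R * b j \in P.
  have -> : \sum_j ((u *m B) 0 j)%:~R * b j =
    \sum_i (u 0 i)%:~R * \sum_j (c (a ^+ i) j)%:~R * b j.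
    under [RHS]eq_bigr => i _ do rewrite mulr_sumr.
    rewrite exchange_big; apply: eq_bigr => j _.
    rewrite mxE rmorph_sum mulr_suml; apply: eq_bigr => i _.
    by rewrite mxE rmorphM mulrA.
  rewrite -sumrB; apply: (prime_ideal_sum PP) => i _.
  by rewrite -mulrBr; apply: (prime_idealMr PP); exact: cP.
have BP (u : 'rV_n) : lin_eval a u \in P -> forall j, (residue_char P %| (u *m B) ord0 j)%Z.
  move=> uP; apply: b_free.
  by have := prime_idealB PP uP (BE u); rewrite opprB addrC subrK.
apply: (@dvdz_det_corank _ n e _ B W D) => //; first exact: residue_char_prime.
- move=> i j; have := BP (row i (mul_mx f v)) _ j; rewrite -row_mul mxE; apply.
  by rewrite rowE (lin_eval_mul af); exact: (prime_idealMr PP).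
move=> i j; rewrite mxE [X in _ + X]mxE [X in - X]mxE.
pose u k := (W *m B) i k - (D *+ (i == k)).
suff /b_free/(_ j) : \sum_k (u k)%:~R * b k \in P by [].
have -> : \sum_k (u k)%:~R * b k = - (lin_eval a (w i) - \sum_k ((w i *m B) 0 k)%:~R * b k).
  rewrite opprB -wP.
  have -> : D%:~R * b i = \sum_k (D *+ (i == k))%:~R * b k.
    rewrite (bigD1 i) //= eqxx big1 ?addr0 // => k ki.
    by rewrite eq_sym (negPf ki) mulr0n mul0r.
  rewrite -sumrB; apply: eq_bigr => k _; rewrite /u intrB mulrBl.
  by rewrite -{1}[w i](rowK w) -/W -row_mul [row _ _ _ _]mxE.
by apply: (prime_idealN PP); exact: BE.
Qed.

Lemma dvd_det_prime (q : nat) v : prime q -> ~~ (q %| D)%Z ->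
  (q %| \det (mul_mx f v))%Z -> exists P : primes_of K, lin_eval a v \in P /\ q%:R \in P.
Proof.
move=> q_pr qD qdet; apply: primes_of_exists => [|y z]; first exact: prime_gt0.
apply/eqP => one.
have /det0P[w0 w0_nz w0A] : \det (map_mx (intr : int -> 'F_q) (mul_mx f v)) == 0.
  by rewrite det_map_mx Fp_intr_eq0.
pose w : 'rV[int]_n := \row_j (nat_of_ord (w0 0 j))%:Z.
have ww0 : map_mx (intr : int -> 'F_q) w = w0.
  by apply/rowP => j; rewrite !mxE; exact: natr_Zp.
have /choice[s sE] j : exists s : int, (w *m mul_mx f v) 0 j = q%:Z * s.
  have : (q %| (w *m mul_mx f v) ord0 j)%Z.
    rewrite -Fp_intr_eq0 //; have /rowP/(_ j) := w0A.
    by rewrite -ww0 -map_mxM !mxE => ->.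
  by case/dvdzP => s ->; exists s; rewrite mulrC.
have wA : lin_eval a w * lin_eval a v = q%:R * lin_eval a (\row_j s j).
  rewrite -(lin_eval_mul af) -(lin_evalZ a q); congr (lin_eval a _).
  by apply/rowP => j; rewrite sE !mxE.
have [t tE] := lin_eval_index (lin_eval a (\row_j s j) * y + lin_eval a w * z).
have Dw : D *: w = q%:Z *: t.
  apply: (lin_eval_inj af); rewrite !lin_evalZ -tE.
  have -> : D%:~R * lin_eval a w =
      D%:~R * ((lin_eval a w * lin_eval a v) * y + lin_eval a w * (q%:R * z)).
    by congr (_ * _); rewrite -mulrA -mulrDr one mulr1.
  by rewrite wA -[q%:~R]/(q%:R); ring.
case/eqP: w0_nz; rewrite -ww0; apply/rowP => j; rewrite [in RHS]mxE mxE; apply/eqP.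
rewrite Fp_intr_eq0 //; have /rowP/(_ j) := Dw; rewrite [_ 0 j]mxE [X in _ = X]mxE => Dwj.
have : (q %| D * w ord0 j)%Z by rewrite Dwj dvdz_mulr.
by rewrite Gauss_dvdzr // coprimezE /= prime_coprime // -dvdzE.
Qed.

End PrimeNorms.

Section Ramification.
Variables (K : fieldExtType rat) (n : nat) (a : integers K) (f : {poly int}).
Hypothesis af : power_order n a f.
Variables D D' : int.
Hypothesis D_index : forall x, exists2 q : {poly int},
  (size q <= n)%N & D%:~R * x = int_eval a q.
Variable y' : integers K.
Hypothesis D'_deriv : int_eval a f^`() * y' = D'%:~R.

(* With [a = c] mod [P] and [f = (X - c) h + f(c)], the element [D h(a)] lies *)
(* outside [P] and multiplies [P] into [p O]; so [p] in [P^2] is impossible.  *)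
Lemma unramified_of_degree_one (P : primes_of K) : inertia_degree P = 1%N ->
  ~~ (residue_char P %| D)%Z -> ~~ (residue_char P %| D')%Z ->
  is_ramification_index P 1.
Proof.
set p := residue_char P => f1 pD pD'; have PP := primes_ofP P.
have p_pr : prime p := residue_char_prime P.
split.
  exists 1%N, (fun=> 1), (fun _ _ => p%:R); split; first by move=> *; exact: mem_residue_char.
  by rewrite !big_ord1 mul1r.
have [c cP] : exists c : int, a - c%:~R \in P.
  have := inertia_degreeP P; rewrite f1 => -[b bP].
  have [u [uP _]] := bP 1; have [v [vP _]] := bP a; move: uP vP; rewrite !big_ord1.
  move: (b 0) (u 0 : nat) (v 0 : nat) => b0 {bP}u0 v0 uP vP.
  have pu : ~~ (p %| u0)%N.
    apply/negP; rewrite -(primes_of_nat P) => u0P; move: uP.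
    rewrite -mulr_natr addrC (prime_ideal_addr PP); first by rewrite (negPf (prime_ideal1 PP)).
    by apply: (prime_idealN PP); exact: (prime_idealMr PP).
  have cop : coprimez u0 p by rewrite coprimezE /= coprime_sym prime_coprime.
  have [k [m km]] : exists k, exists m, k * u0%:Z + m * p%:Z = 1 :> int.
    by case: (Bezoutz u0 p%:Z) => k [m km]; exists k, m; rewrite km; apply/eqP.
  exists (v0%:Z * k).
  have kmO : (m%:~R : integers K) * p%:R = 1 - k%:~R * u0%:R.
    apply/eqP; rewrite eq_sym subr_eq -[p%:R]/(p%:Z%:~R) -[u0%:R]/(u0%:Z%:~R).
    by rewrite -!intrM -intrD addrC km.
  have -> : a - (v0%:Z * k)%:~R =
      (a - b0 *+ v0) + v0%:R * b0 * (m%:~R * p%:R) - v0%:R * k%:~R * (1 - b0 *+ u0).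
    by rewrite kmO intrM -[v0%:~R]/(v0%:R) -[b0 *+ v0]mulr_natr -[b0 *+ u0]mulr_natr; ring.
  apply: (prime_idealB PP); last exact: (prime_idealMr PP).
  apply: (prime_idealD PP) => //; apply/(prime_idealMr PP)/(prime_idealMr PP).
  exact: mem_residue_char.
have taylor (q : {poly int}) : exists q1 : {poly int}, q = q1 * ('X - c%:P) + q.[c]%:P.
  have /factor_theorem[q1 qE] : root (q - q.[c]%:P) c by rewrite rootE !hornerE subrr.
  by exists q1; rewrite -qE subrK.
have evXc : int_eval a ('X - c%:P) = a - c%:~R.
  by rewrite -polyCN int_evalD int_evalX int_evalC mulrNz.
have taylor_eval (q : {poly int}) : int_eval a q \in P -> (p %| q.[c])%Z.
  have [q1 ->] := taylor q; rewrite int_evalD int_evalM evXc int_evalC => qP.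
  rewrite !hornerE subrr mulr0 add0r -primes_of_int.
  by move: qP; rewrite (prime_ideal_addr PP) //; exact: (prime_idealMr PP).
have [h fE] := taylor f.
have /dvdzP[fc fcE] : (p %| f.[c])%Z.
  by apply: taylor_eval; rewrite (power_order_root af) (prime_ideal0 PP).
have haP : int_eval a h \notin P.
  apply: contra pD' => haP; rewrite -primes_of_int -D'_deriv.
  apply: (prime_idealMl PP); rewrite fE derivD derivM derivC addr0 derivXsubC mulr1.
  rewrite int_evalD int_evalM evXc.
  by apply: (prime_idealD PP) => //; exact: (prime_idealMr PP).
pose e := D%:~R * int_eval a h.
have eP : e \notin P.
  apply/negP => /(prime_ideal_mul PP)/orP[|]; last by rewrite (negPf haP).
  by rewrite primes_of_int (negPf pD).
have e_mul x : x \in P -> exists t, e * x = p%:R * t.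
  move=> xP; have [q _ qE] := D_index x.
  have /dvdzP[qc qcE] : (p %| q.[c])%Z.
    by apply: taylor_eval; rewrite -qE; exact: (prime_idealMr PP).
  have [q1 q1E] := taylor q.
  have fa : int_eval a h * (a - c%:~R) = - (fc%:~R * p%:R).
    have := power_order_root af; rewrite fE int_evalD int_evalM evXc int_evalC fcE intrM.
    by move/eqP; rewrite addr_eq0 => /eqP.
  exists (int_eval a h * qc%:~R - int_eval a q1 * fc%:~R).
  have -> : e * x = int_eval a h * (int_eval a q1 * (a - c%:~R) + qc%:~R * p%:R).
    rewrite -[p%:R]/(p%:Z%:~R) -evXc -intrM -qcE -(int_evalC a) -int_evalM -int_evalD -q1E -qE.
    by rewrite /e; ring.
  rewrite mulrDr mulrCA fa; ring.
case=> k [d [x [xP pE]]].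
have /choice[t tE] (ij : 'I_k * 'I_2) : exists t, e * x ij.1 ij.2 = p%:R * t.
  exact: e_mul.
have e2 : e ^+ 2 = p%:R * \sum_i d i * (t (i, ord0) * t (i, ord_max)).
  have p0 : p%:Z != 0 by rewrite eqz_nat -lt0n prime_gt0.
  apply: (integer_mulrI p0); rewrite -[p%:Z%:~R]/(p%:R) mulrC {1}pE mulr_sumr !mulr_sumr.
  apply: eq_bigr => i _; rewrite big_ord_recl big_ord1.
  have -> : lift ord0 ord0 = ord_max :> 'I_2 by apply: val_inj.
  have := tE (i, ord0); have /= := tE (i, ord_max); move=> /= t1 t0.
  have -> : e ^+ 2 * (d i * (x i ord0 * x i ord_max)) =
     d i * ((e * x i ord0) * (e * x i ord_max)) by ring.
  by rewrite t0 t1; ring.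
move/negP: eP; apply; apply: (@prime_ideal_exp _ _ PP _ 2); rewrite e2.
by apply: (prime_idealMl PP); exact: mem_residue_char.
Qed.

End Ramification.

(** * Divergence of the sum of inverse norms *)

Section Counting.
Variables (n N : nat).
Implicit Types y z : {ffun 'I_n -> 'I_N.+1}.

Lemma card_separated m (E : {set {ffun 'I_n -> 'I_N.+1}}) :
  {in E &, forall y z, (forall i, y i %/ m = z i %/ m)%N -> y = z} ->
  (#|E| <= (N %/ m).+1 ^ n)%N.
Proof.
move=> sepE; pose g y : {ffun 'I_n -> 'I_(N %/ m).+1} := [ffun i => inord (y i %/ m)].
have -> : ((N %/ m).+1 ^ n)%N = #|{ffun 'I_n -> 'I_(N %/ m).+1}| by rewrite card_ffun !card_ord.
apply: (@leq_card_in _ _ g) => y z yE zE gyz; apply: sepE => // i.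
have := congr1 (fun h : {ffun _ -> _} => nat_of_ord (h i)) gyz.
by rewrite !ffunE !inordK // ltnS leq_div2r // -ltnS.
Qed.

Lemma card_line_fibers (i0 : 'I_n) k (E : {set {ffun 'I_n -> 'I_N.+1}}) :
  (forall y, #|[set z in E | [forall i, (i != i0) ==> (z i == y i)]]| <= k)%N ->
  (#|E| <= N.+1 ^ n.-1 * k)%N.
Proof.
move=> fibE; pose g y : {ffun 'I_n.-1 -> 'I_N.+1} := [ffun i => y (lift i0 i)].
have -> : (N.+1 ^ n.-1)%N = #|{ffun 'I_n.-1 -> 'I_N.+1}| by rewrite card_ffun !card_ord.
rewrite -sum1_card (partition_big g predT) //= -sum_nat_const leq_sum // => h _.
have [y /andP[yE /eqP gy]|none] := pickP (fun y => (y \in E) && (g y == h)); last first.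
  by rewrite big_pred0.
apply: leq_trans (fibE y); rewrite sum1_card; apply/subset_leq_card/fintype.subsetP => z.
rewrite unfold_in => /andP[zE /eqP gz]; rewrite inE zE /=; apply/forallP => i; apply/implyP.
case: (unliftP i0 i) => [j ->|->]; last by rewrite eqxx.
move=> _; move: gy; rewrite -gz => /(congr1 (fun h : {ffun _ -> _} => h j)).
by rewrite !ffunE => ->.
Qed.

End Counting.

Lemma absz_leqD (x y : int) : (`|(x + y)%R| <= `|x| + `|y|)%N.
Proof. lia. Qed.

Section NormCounting.
Variables (K : fieldExtType rat) (n : nat) (a : integers K) (f : {poly int}).
Hypothesis af : power_order n a f.
Implicit Types v : 'rV[int]_n.

Let i0 := Ordinal (power_order_gt0 af).

Lemma mul_mxD u v : mul_mx f (u + v) = mul_mx f u + mul_mx f v.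
Proof. by rewrite -big_split; apply: eq_bigr => k _; rewrite !mxE scalerDl. Qed.

Lemma mul_mxZ c v : mul_mx f (c *: v) = c *: mul_mx f v.
Proof. by rewrite scaler_sumr; apply: eq_bigr => k _; rewrite !mxE scalerA. Qed.

Lemma mul_mx_unit : mul_mx f (delta_mx 0 i0) = 1%:M.
Proof.
rewrite /mul_mx (bigD1 i0) //= big1 ?addr0 => [|k ki]; rewrite !mxE.
  by rewrite !eqxx scale1r (power_mx0 af).
by rewrite (negPf ki) andbF scale0r.
Qed.

Lemma mul_mx_det_neq0 v : v != 0 -> \det (mul_mx f v) != 0.
Proof.
apply: contra => /det0P[w w0 wA]; have /eqP := lin_eval_mul af w v.
have ev0 : lin_eval a (0 : 'rV[int]_n) = 0.
  by rewrite /lin_eval big1 // => j _; rewrite mxE mul0r.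
rewrite wA ev0 eq_sym integer_mul_eq0 -!ev0 !(inj_eq (lin_eval_inj af)).
by rewrite (negPf w0).
Qed.

Lemma mul_mx_det_bound : exists2 C : nat, (0 < C)%N & forall v (m : nat),
  (forall j, `|v 0%R j| <= m)%N -> (`|\det (mul_mx f v)| <= C * m ^ n)%N.
Proof.
pose E := (\sum_(k < n) \sum_(i < n) \sum_(j < n) `|power_mx n f k i j|)%N.
exists (n`! * E.+1 ^ n)%N; first by rewrite muln_gt0 fact_gt0 expn_gt0.
move=> v m vm.
have absz_sum (T : Type) (r : seq T) (F : T -> int) :
    (`|(\sum_(i <- r) F i)%R| <= \sum_(i <- r) `|F i|)%N.
  apply: (big_ind2 (fun (x : int) y => `|x| <= y)%N) => // x1 x2 y1 y2 h1 h2.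
  exact: leq_trans (absz_leqD _ _) (leq_add h1 h2).
have absz_prod (T : Type) (r : seq T) (F : T -> int) :
    `|(\prod_(i <- r) F i)%R|%N = (\prod_(i <- r) `|F i|)%N.
  by apply: (big_morph absz abszM).
have entry i j : (`|mul_mx f v i j| <= E.+1 * m)%N.
  rewrite /mul_mx summxE; apply: leq_trans (absz_sum _ _ _) _.
  apply: (@leq_trans (E * m)%N); last by rewrite leq_mul2r leqnSn orbT.
  rewrite big_distrl; apply: leq_sum => k _ /=; rewrite mxE abszM mulnC leq_mul //.
  by rewrite (bigD1 i) //= (bigD1 j) //= -addnA leq_addr.
rewrite /determinant; apply: leq_trans (absz_sum _ _ _) _.
apply: (@leq_trans (\sum_(s : 'S_n) (E.+1 * m) ^ n)%N); last first.
  by rewrite sum_nat_const card_Sn expnMn mulnA.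
apply: leq_sum => s _; rewrite abszMsign absz_prod.
apply: leq_trans (_ : \prod_(i < n) (E.+1 * m) <= _)%N; first exact: leq_prod.
by rewrite prod_nat_const card_ord.
Qed.

Section Box.
Variables (N M : nat).
Hypothesis M_gt0 : (0 < M)%N.
Implicit Types y z : {ffun 'I_n -> 'I_N.+1}.

Definition box_row y : 'rV[int]_n := \row_j (y j)%:Z.

Definition shifted_row y : 'rV[int]_n := delta_mx 0 i0 + M%:Z *: box_row y.

Lemma shifted_row_neq0 y : shifted_row y != 0.
Proof.
apply/negP => /eqP/rowP/(_ i0); rewrite !mxE !eqxx /= => /eqP.
by rewrite -PoszM -PoszD.
Qed.

Lemma shifted_row_bound y j : (`|shifted_row y 0%R j| <= M * N.+1)%N.
Proof.
rewrite !mxE eqxx /= natz -PoszM -PoszD absz_nat.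
apply: (@leq_trans (1 + M * N)%N); last by rewrite mulnS leq_add2r.
by rewrite leq_add ?leq_b1 // leq_mul2l -ltnS ltn_ord orbT.
Qed.

Lemma box_row_inj : injective box_row.
Proof.
move=> y z /rowP yz; apply/ffunP => j; apply: val_inj.
by have := yz j; rewrite !mxE => -[].
Qed.

(* Along a line parallel to the first axis the norm is a polynomial of degree *)
(* [n], which takes each of the values 1 and -1 at most [n] times.            *)
Lemma card_units :
  (#|[set y | `|\det (mul_mx f (shifted_row y))| == 1%N]| <= N.+1 ^ n.-1 * n.*2)%N.
Proof.
apply: (card_line_fibers (i0 := i0)) => y.
set F := [set z in _ | _].
pose B := mul_mx f (shifted_row y) - (M * y i0)%:Z%:M.
pose chi := char_poly (- B).
have detE z : z \in F -> \det (mul_mx f (shifted_row z)) = chi.[(M * z i0)%:Z].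
  rewrite inE => /andP[_ /forallP zy].
  have zrow : shifted_row z = shifted_row y + ((M * z i0)%:Z - (M * y i0)%:Z) *: delta_mx 0 i0.
    rewrite /shifted_row -addrA; congr (_ + _); apply/rowP => j; rewrite !mxE eqxx /=.
    have [->|ji] := eqVneq j i0; first by rewrite mulr1 !PoszM; ring.
    by rewrite mulr0 addr0; have := zy j; rewrite ji => /eqP->.
  rewrite zrow mul_mxD mul_mxZ mul_mx_unit scalemx1 /chi /char_poly -horner_evalE -det_map_mx.
  congr (\det _); rewrite /char_poly_mx map_mxB map_scalar_mx /= horner_evalE hornerX.
  rewrite -map_mx_comp (_ : map_mx _ (- B) = - B) ?opprK /B; last first.
    by apply/matrixP => i j; rewrite !mxE /= horner_evalE hornerC.
  by rewrite raddfB /= addrCA.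
have chi_mon : chi \is monic := char_poly_monic _.
have szchi : size chi = n.+1 := size_char_poly _.
have [q [q0 szq qroot]] : exists q : {poly int}, [/\ q != 0, (size q <= n.*2.+1)%N &
    forall x, `|chi.[x]|%N = 1%N -> root q x].
  have chi_c (c : int) : size (chi + c%:P) = n.+1.
    rewrite size_polyDl szchi // (leq_ltn_trans (size_polyC_leq1 _)) // ltnS.
    exact: power_order_gt0 af.
  have chi_c0 (c : int) : chi + c%:P != 0 by rewrite -size_poly_gt0 chi_c.
  exists ((chi + (-1)%:P) * (chi + 1%:P)); split; first by rewrite mulf_neq0.
    by rewrite size_mul // !chi_c addSn addnS /= addnn.
  move=> x chix; rewrite rootM !rootE !hornerE.
  by case: chi.[x] chix => [[|[|k]]|[|k]].
have uniqF : uniq [seq (M * z i0)%:Z | z : {ffun 'I_n -> 'I_N.+1} in F].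
  rewrite map_inj_in_uniq ?enum_uniq // => z z'; rewrite !mem_enum => zF z'F /eqP.
  rewrite eqz_nat eqn_pmul2l // => /eqP zz'; apply/ffunP => j.
  have [->|ji] := eqVneq j i0; first exact: val_inj.
  move: zF z'F; rewrite !inE => /andP[_ /forallP/(_ j)] + /andP[_ /forallP/(_ j)].
  by rewrite ji => /eqP-> /eqP->.
have rootF : all (root q) [seq (M * z i0)%:Z | z : {ffun 'I_n -> 'I_N.+1} in F].
  apply/allP => _ /mapP[z + ->]; rewrite mem_enum => zF; apply: qroot.
  by rewrite -detE //; move: zF; rewrite !inE => /andP[/eqP].
have := max_poly_roots q0 rootF uniqF; rewrite size_map -cardE => Fq.
by rewrite -ltnS (leq_trans Fq).
Qed.

Variable D : int.
Hypothesis D_index : forall x, exists2 q : {poly int},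
  (size q <= n)%N & D%:~R * x = int_eval a q.
Hypothesis D_M : (D %| M%:Z)%Z.

Lemma prime_of_nonunit y : `|\det (mul_mx f (shifted_row y))|%N != 1%N ->
  exists P : primes_of K, lin_eval a (shifted_row y) \in P /\ coprime (residue_char P) M.
Proof.
move=> detN1.
have [q [q_pr qdet]] : exists q, prime q /\ (q %| \det (mul_mx f (shifted_row y)))%Z.
  have := mul_mx_det_neq0 (shifted_row_neq0 y); rewrite -absz_gt0.
  move: detN1; set d := absz _ => d1 d0; exists (pdiv d).
  by rewrite pdiv_prime ?dvdzE ?pdiv_dvd // ltn_neqAle eq_sym d1.
have qM : ~~ (q %| M)%N.
  apply/negP => qM; move: qdet; rewrite -Fp_intr_eq0 // -det_map_mx.
  rewrite mul_mxD mul_mxZ mul_mx_unit map_mxD map_mxZ map_mx1 /=.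
  have /eqP-> : (M%:Z%:~R : 'F_q) == 0 by rewrite Fp_intr_eq0 // dvdzE.
  by rewrite scale0r addr0 det1 oner_eq0.
have qD : ~~ (q %| D)%Z.
  apply: contra qM; rewrite -[(q %| M)%N]/((q %| M%:Z)%Z) => qD; exact: dvdz_trans qD D_M.
have [P [vP qP]] := dvd_det_prime af D_index q_pr qD qdet.
exists P; split=> //; have /primes_aboveE-/(_ q_pr) -> := qP.
by rewrite prime_coprime.
Qed.

End Box.
End NormCounting.

Section PrimeCount.
Variables (K : fieldExtType rat) (n : nat) (a : integers K) (f : {poly int}).
Hypothesis af : power_order n a f.
Variable D : int.
Hypothesis D_index : forall x, exists2 q : {poly int},
  (size q <= n)%N & D%:~R * x = int_eval a q.
Variable C : nat.
Hypothesis C_gt0 : (0 < C)%N.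
Hypothesis C_bound : forall (v : 'rV[int]_n) (m : nat),
  (forall j, `|v 0%R j| <= m)%N -> (`|\det (mul_mx f v)| <= C * m ^ n)%N.
Variables (N M : nat).
Hypotheses (M_gt0 : (0 < M)%N) (D_M : (D %| M%:Z)%Z).

Definition prime_box (P : primes_of K) : {set {ffun 'I_n -> 'I_N.+1}} :=
  [set y | lin_eval a (shifted_row af M y) \in P].

Variable P : primes_of K.
Hypothesis P_M : coprime (residue_char P) M.

Let P_D : ~~ (residue_char P %| D)%Z.
Proof.
apply: contraL P_M => PD; rewrite prime_coprime ?residue_char_prime // negbK.
exact: dvdz_trans PD D_M.
Qed.

Lemma norm_of_gt0 (Q : primes_of K) : (0 < norm_of Q)%N.
Proof. by rewrite expn_gt0 prime_gt0 // residue_char_prime. Qed.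

Lemma prime_box_separated m : (C * m ^ n < norm_of P)%N ->
  {in prime_box P &, forall y z : {ffun 'I_n -> 'I_N.+1},
    (forall i, y i %/ m.+1 = z i %/ m.+1)%N -> y = z}.
Proof.
move=> mP y z; rewrite !inE => yP zP yz; apply: contraTeq mP => nyz; rewrite -leqNgt.
have PP := primes_ofP P.
pose v := box_row y - box_row z.
have v0 : v != 0 by rewrite subr_eq0 (inj_eq (@box_row_inj _ _)).
have vP : lin_eval a v \in P.
  have : M%:Z%:~R * lin_eval a v \in P.
    have -> : M%:Z%:~R * lin_eval a v =
        lin_eval a (shifted_row af M y) - lin_eval a (shifted_row af M z).
      rewrite -lin_evalB -lin_evalZ /shifted_row; congr (lin_eval a _).
      by rewrite scalerBr opprD addrACA subrr add0r.
    exact: (prime_idealB PP).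
  case/(prime_ideal_mul PP)/orP => //; rewrite primes_of_nat => pM.
  by move: P_M; rewrite prime_coprime ?residue_char_prime // pM.
apply: (@leq_trans `|\det (mul_mx f v)|%N).
  apply: dvdn_leq; first by rewrite absz_gt0 (mul_mx_det_neq0 af).
  exact: (norm_dvd_det af D_index P_D vP).
apply: C_bound => j; rewrite !mxE; have := yz j.
move: (nat_of_ord (y j)) (nat_of_ord (z j)) => s t st.
have := divn_eq s m.+1; have := divn_eq t m.+1; rewrite st.
have := ltn_pmod s (ltn0Sn m); have := ltn_pmod t (ltn0Sn m).
move: (s %% m.+1)%N (t %% m.+1)%N (t %/ m.+1)%N => s' t' k ht hs -> ->.
lia.
Qed.

Lemma card_prime_box_large : (C * N.+1 ^ n < norm_of P)%N -> (#|prime_box P| <= 1)%N.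
Proof.
move=> NP; have NP' : (C * N ^ n < norm_of P)%N.
  by apply: leq_ltn_trans NP; rewrite leq_mul2l leq_exp2r ?leqnSn ?orbT // (power_order_gt0 af).
apply: leq_trans (card_separated (prime_box_separated NP')) _.
by rewrite divn_small // exp1n.
Qed.

Lemma card_prime_box_small : (norm_of P <= C * N.+1 ^ n)%N ->
  (#|prime_box P| * norm_of P <= C * 2 ^ n * N.+1 ^ n)%N.
Proof.
move=> NP; have n0 := power_order_gt0 af.
pose ok m := (C * m ^ n < norm_of P)%N.
have ok0 : exists m, ok m by exists 0%N; rewrite /ok exp0n // muln0 norm_of_gt0.
have okM m : ok m -> (m <= N)%N.
  by rewrite /ok => /leq_trans/(_ NP); rewrite ltn_pmul2l // ltn_exp2r.
case: (ex_maxnP ok0 okM) => m okm maxm.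
have Nm : (norm_of P <= C * m.+1 ^ n)%N.
  by rewrite leqNgt; apply/negP => /maxm; rewrite ltnn.
have cardP := card_separated (prime_box_separated okm).
apply: leq_trans (leq_mul cardP Nm) _.
rewrite mulnCA -mulnA leq_mul2l -!expnMn leq_exp2r //; apply/orP; right.
rewrite mulSn (leq_trans (leq_add (leqnn _) (leq_divM _ _))) //.
by rewrite mul2n -addnn; apply: leq_add; rewrite ?leqnSn // ltnS okM.
Qed.

End PrimeCount.

Section Divergence.
Variables (R : realType) (K : fieldExtType rat).

Definition inv_norm (P : primes_of K) : R := (norm_of P)%:R^-1.

(* Counts the [y] in a box of side [N.+1] by a prime dividing [1 + M y], *)
(* where all primes up to [Y] divide [M]; the first term counts the units.    *)
Lemma sieve : exists n C : nat, (0 < n)%N /\ forall Y : nat, exists B : nat,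
  forall N : nat, exists G : seq (primes_of K),
    [/\ uniq G, {in G, forall P, Y < residue_char P}%N &
      (N.+1 ^ n)%:R <= (N.+1 ^ n.-1 * n.*2)%:R + (N.+1 ^ n)%:R *
        (C%:R * \sum_(P <- G) inv_norm P
         + B%:R * \sum_(P <- G | (N < norm_of P)%N) inv_norm P) :> R].
Proof.
have [n [a [f af]]] := power_order_exists K.
have [D D0 D_index] := power_order_index af.
have [C C0 C_bound] := mul_mx_det_bound n f.
exists n, (C * 2 ^ n)%N; split=> [|Y]; first exact: power_order_gt0 af.
pose M := (`|D| * Y`!)%N.
have M0 : (0 < M)%N by rewrite muln_gt0 absz_gt0 D0 fact_gt0.
have DM : (D %| M%:Z)%Z by rewrite dvdzE dvdn_mulr.
exists (C * M ^ n)%N => N.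
pose box := {ffun 'I_n -> 'I_N.+1}.
pose unit_box := [set y : box | `|\det (mul_mx f (shifted_row af M y))|%N == 1%N].
have /choice[Ps PsP] (y : box) : exists Ps : seq (primes_of K),
    {in Ps, forall P, [/\ coprime (residue_char P) M & norm_of P <= C * M ^ n * N.+1 ^ n]%N}
    /\ (y \notin unit_box -> has (fun P => y \in prime_box af N M P) Ps).
  have [yU|yU] := boolP (y \in unit_box); first by exists [::].
  have [|P [yP cop]] := prime_of_nonunit (af := af) D_index DM (y := y); first by move: yU; rewrite inE.
  exists [:: P]; split=> [Q|_]; last by rewrite /= inE yP.
  rewrite inE => /eqP->; split=> //.
  have PD : ~~ (residue_char P %| D)%Z.
    apply: contraL cop => PD; rewrite prime_coprime ?residue_char_prime // negbK.
    exact: dvdz_trans PD DM.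
  rewrite -mulnA -expnMn; apply: leq_trans (C_bound _ _ (shifted_row_bound af M0 y)).
  apply: dvdn_leq; last exact: (norm_dvd_det af D_index PD yP).
  by rewrite absz_gt0 (mul_mx_det_neq0 af) // shifted_row_neq0.
pose G := undup (flatten [seq Ps y | y : box]).
have GP P : P \in G -> [/\ coprime (residue_char P) M & norm_of P <= C * M ^ n * N.+1 ^ n]%N.
  by rewrite mem_undup => /flattenP[_ /mapP[y _ ->]]; case: (PsP y) => + _; apply.
exists G; split; first exact: undup_uniq.
  move=> P /GP[cop _]; rewrite ltnNge; apply: contraL cop => PY.
  rewrite prime_coprime ?residue_char_prime // negbK dvdn_mull //.
  by rewrite dvdn_fact // prime_gt0 ?residue_char_prime.
have count : (N.+1 ^ n <= #|unit_box| + \sum_(P <- G) #|prime_box af N M P|)%N.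
  have -> : (N.+1 ^ n)%N = (\sum_(y : box) 1)%N by rewrite sum1_card card_ffun !card_ord.
  have -> : #|unit_box| = (\sum_(y : box) (y \in unit_box))%N.
    by rewrite -sum1_card big_mkcond; apply: eq_bigr => y _; case: (y \in _).
  have -> : (\sum_(P <- G) #|prime_box af N M P| =
      \sum_(y : box) \sum_(P <- G) (y \in prime_box af N M P))%N.
    rewrite exchange_big; apply: eq_bigr => P _; rewrite -sum1_card big_mkcond.
    by apply: eq_bigr => y _; case: (y \in _).
  rewrite -big_split; apply: leq_sum => y _ /=.
  have [//|yU] := boolP (y \in unit_box); rewrite add0n.
  have [/hasP[P Py yP]] := (PsP y).2 yU.
  have PG : P \in G by rewrite mem_undup; apply/flatten_imageP; exists y.
  by rewrite (big_rem P) //= yP.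
apply: le_trans (_ : (#|unit_box| + \sum_(P <- G) #|prime_box af N M P|)%:R <= _).
  by rewrite ler_nat.
rewrite natrD lerD ?ler_nat ?card_units // natr_sum [X in _ * (_ + _ * X)]big_mkcond /=.
rewrite !mulr_sumr -big_split mulr_sumr big_seq [leRHS]big_seq ler_sum // => P /GP[cop NP].
have N0 : 0 < (norm_of P)%:R :> R by rewrite ltr0n norm_of_gt0.
rewrite -(ler_pM2r N0) -mulrA [X in _ <= _ * X]mulrDl -!mulrA mulVf ?gt_eqF // mulr1.
have [small|large] := leqP (norm_of P) (C * N.+1 ^ n).
  have := card_prime_box_small af D_index C0 C_bound M0 DM cop small.
  rewrite -(ler_nat R) !natrM => /le_trans; apply.
  rewrite [leLHS]mulrC ler_wpM2l ?ler0n // lerDl mulr_ge0 ?ler0n //.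
  by case: ifP => _; rewrite ?mul0r // mulVf ?gt_eqF.
have := card_prime_box_large af D_index C0 C_bound M0 DM cop large.
have NnP : (N < norm_of P)%N.
  apply: leq_trans large; rewrite ltnS (leq_trans (leqnSn N)) //.
  by rewrite -[leqLHS]mul1n leq_mul // -{1}[N.+1]expn1 leq_pexp2l // (power_order_gt0 af).
rewrite NnP mulVf ?gt_eqF // mulr1 -(ler_nat R) => card1.
rewrite (le_trans (ler_wpM2r (ltW N0) card1)) // mul1r mulrDr ler_wpDl //.
by rewrite -natrM ler_nat mulnC.
Qed.

End Divergence.

Section Density.
Variables (R : realType) (K : fieldExtType rat).
Local Notation inv_norm := (inv_norm R (K := K)).

Lemma inv_norm_tail (A : R) :
  (forall s : seq (primes_of K), uniq s -> \sum_(P <- s) inv_norm P <= A) ->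
  forall e : R, 0 < e -> exists s0 : seq (primes_of K), forall s, uniq s ->
    {in s, forall P, P \notin s0} -> \sum_(P <- s) inv_norm P < e.
Proof.
move=> A_ub e e0.
pose E : set R := [set x | exists s : seq (primes_of K), uniq s /\ x = \sum_(P <- s) inv_norm P]%classic.
have supE : has_sup E.
  split; first by exists 0, [::]; rewrite big_nil.
  by exists A => _ [s [us ->]]; exact: A_ub.
have [_ [s0 [us0 ->]] s0e] := sup_adherent e0 supE.
exists s0 => s us s_s0.
have : \sum_(P <- s0 ++ s) inv_norm P <= sup E.
  apply: (sup_upper_bound supE); exists (s0 ++ s); split=> //.
  rewrite cat_uniq us0 us andbT /=; apply/hasPn => P; exact: s_s0.
by rewrite big_cat /=; lra.
Qed.

Lemma inv_norm_diverges (A : R) :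
  exists s : seq (primes_of K), uniq s /\ A < \sum_(P <- s) inv_norm P.
Proof.
apply: contrapT => noS.
have {}tail : forall e : R, 0 < e -> exists s0 : seq (primes_of K), forall s, uniq s ->
    {in s, forall P, P \notin s0} -> \sum_(P <- s) inv_norm P < e.
  apply: (@inv_norm_tail A) => s us; rewrite leNgt; apply/negP => As.
  by apply: noS; exists s.
have [n [C [n0 sieveC]]] := sieve R K.
have q4 (k : nat) : 0 < (4 * k.+1%:R)^-1 :> R by rewrite invr_gt0 mulr_gt0 ?ltr0n.
have q4k (k : nat) (x : R) : x < (4 * k.+1%:R)^-1 -> k%:R * x <= 1 / 4.
  move=> /ltW xk; have := ler_wpM2l (ler0n R k) xk => /le_trans; apply.
  have k1 : 0 < k.+1%:R :> R by rewrite ltr0n.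
  by rewrite invfM mulrCA div1r ler_piMr ?invr_ge0 ?ler0n // ler_pdivrMr // mul1r ler_nat.
have [s0 s0P] := tail _ (q4 C).
have [B sieveB] := sieveC (\max_(P <- s0) residue_char P).
have [s1 s1P] := tail _ (q4 B).
pose N := maxn (\max_(P <- s1) norm_of P) (8 * n).
have [G [G_uniq G_s0 sieveN]] := sieveB N.
have /q4k sumC : \sum_(P <- G) inv_norm P < (4 * C.+1%:R)^-1.
  apply: s0P => // P /G_s0; rewrite ltnNge; apply: contra => Ps0.
  by apply: (leq_bigmax_seq (F := @residue_char K)).
have /q4k sumB : \sum_(P <- G | (N < norm_of P)%N) inv_norm P < (4 * B.+1%:R)^-1.
  rewrite -big_filter; apply: s1P => [|P]; first exact: filter_uniq.
  rewrite mem_filter ltnNge => /andP[+ _]; apply: contra => Ps1.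
  by rewrite leq_max (leq_bigmax_seq (F := @norm_of K) P).
have X0 : 0 < (N.+1 ^ n)%:R :> R by rewrite ltr0n expn_gt0.
have unitN : (N.+1 ^ n.-1 * n.*2)%:R <= (N.+1 ^ n)%:R * (1 / 4) :> R.
  rewrite mulrA mulr1 ler_pdivlMr // -natrM ler_nat -[n in leqRHS](prednK n0) expnSr.
  by rewrite -mulnA leq_mul2l; apply/orP; right; rewrite /N; lia.
have := ler_wpM2l (ltW X0) (lerD sumC sumB); move: sieveN X0 unitN; lra.
Qed.

Lemma powR_sum_bounded (t : R) : 1 < t ->
  exists B : R, forall m, \sum_(1 <= k < m) k%:R `^ (- t) <= B.
Proof.
move=> t1; pose r : R := 2 `^ (1 - t).
have r0 : 0 < r by rewrite powR_gt0.
have r1 : r < 1.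
  rewrite lt_neqAle powR_eq1 -[X in _ && (_ <= X)](powRr0 2) ler_powR ?ler1n //; last by lra.
  by rewrite !negb_or -leNgt ler0n (eqr_nat R 2 1) andbT /=; lra.
exists (1 - r)^-1 => m.
have pow_ge0 k : 0 <= (k%:R : R) `^ (- t) by exact: powR_ge0.
have dyadic j : \sum_(1 <= k < 2 ^ j) (k%:R : R) `^ (- t) <= \sum_(i < j) r ^+ i.
  elim: j => [|j IHj]; first by rewrite big_geq // big_ord0.
  rewrite big_ord_recr /= (big_cat_nat _ (n := (2 ^ j)%N)) ?expn_gt0 ?leq_exp2l //=.
  rewrite lerD //; apply: (@le_trans _ _ (\sum_(2 ^ j <= k < 2 ^ j.+1) ((2 ^ j)%:R : R) `^ (- t))).
    rewrite big_nat_cond [leRHS]big_nat_cond; apply: ler_sum => k /andP[/andP[jk _] _].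
    rewrite !powRN lef_pV2 ?posrE ?powR_gt0 ?ltr0n ?expn_gt0 //; last first.
      by rewrite (leq_trans _ jk) // expn_gt0.
    by rewrite ge0_ler_powR ?nnegrE ?ler0n ?ler_nat //; lra.
  rewrite sumr_const_nat expnS mul2n -addnn addnK.
  have two_pow : (2 ^ j)%:R = 2 `^ j%:R :> R by rewrite natrX powR_mulrn.
  rewrite -[leLHS]mulr_natl two_pow -powRrM -powRD ?pnatr_eq0 ?implybT //.
  rewrite /r -(powR_mulrn _ (powR_ge0 _ _)) -powRrM le_eqVlt; apply/orP; left; apply/eqP.
  by congr (_ `^ _); ring.
have geom j : \sum_(i < j) r ^+ i <= (1 - r)^-1.
  rewrite -[leRHS]mul1r ler_pdivlMr ?subr_gt0 // mulrC -opprB mulNr -subrX1 opprB.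
  by rewrite lerBlDr lerDl exprn_ge0 // ltW.
apply: le_trans (geom m); apply: le_trans (dyadic m).
have [m1|m1] := leqP m 1; first by rewrite big_geq // sumr_ge0.
rewrite [leRHS](big_cat_nat _ (n := m)) ?(ltnW m1) //=; last by rewrite ltnW // ltn_expl.
by rewrite lerDl sumr_ge0.
Qed.

Lemma prime_sum_le (g : nat -> R) (B : R) (s : seq (primes_of K)) : uniq s ->
  (forall k, 0 <= g k) -> (forall m, \sum_(1 <= k < m) g k <= B) ->
  \sum_(P <- s) g (residue_char P) <= (\dim {:K})%:R * B.
Proof.
move=> us g0 gB; pose m := (\max_(P <- s) residue_char P).+1.
have -> : \sum_(P <- s) g (residue_char P) =
    \sum_(1 <= k < m) \sum_(P <- s | residue_char P == k) g k.
  under [RHS]eq_bigr => k _ do rewrite big_mkcond.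
  rewrite exchange_big; rewrite big_seq [RHS]big_seq; apply: eq_bigr => P Ps.
  rewrite -big_mkcond /= (big_rem (residue_char P)) /=; last first.
    by rewrite mem_index_iota prime_gt0 ?residue_char_prime // ltnS (leq_bigmax_seq (F := @residue_char K) P).
  rewrite eqxx big_seq_cond big_pred0 ?addr0 // => k.
  apply/negP => /andP[+ /eqP Pk]; rewrite -Pk mem_rem_uniq ?iota_uniq //.
  by rewrite inE /= eqxx.
apply: le_trans (ler_wpM2l (ler0n _ _) (gB m)); rewrite mulr_sumr ler_sum // => k _.
rewrite -big_filter big_const_seq count_predT iter_addr_0 -[leLHS]mulr_natl ler_wpM2r // ler_nat.
apply: (@size_primes_above _ k); first exact: filter_uniq.
by move=> P; rewrite mem_filter => /andP[/eqP].
Qed.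

End Density.

(** * Density of the primes of degree one *)

Section Density.
Variables (R : realType) (K : fieldExtType rat).
Local Open Scope classical_set_scope.
Local Notation w s := (fun P : primes_of K => (norm_of P)%:R `^ (- s) : R).

Lemma esum_le_finite (S : set (primes_of K)) (g : primes_of K -> R) (B : R) :
  (forall s : seq (primes_of K), uniq s -> {in s, forall P, S P} -> \sum_(P <- s) g P <= B) ->
  (\esum_(P in S) (g P)%:E <= B%:E)%E.
Proof.
move=> gB; apply: ge_ereal_sup => _ [X [finX XS] <-].
rewrite fsumEFin // lee_fin fsbig_finite //=; apply: gB; first exact: fset_uniq.
by move=> P; rewrite in_fset_set // inE => /XS.
Qed.

Lemma norm_of_powR_le (s : R) (P : primes_of K) : 0 <= s ->
  (norm_of P)%:R `^ (- s) <= (residue_char P)%:R `^ (- s) :> R.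
Proof.
move=> s0; have p0 : (0 < residue_char P)%N by rewrite prime_gt0 ?residue_char_prime.
rewrite !powRN lef_pV2 ?posrE ?powR_gt0 ?ltr0n ?norm_of_gt0 //.
rewrite ge0_ler_powR ?nnegrE ?ler0n // ler_nat.
by rewrite -[leqLHS]expn1 leq_pexp2l // inertia_degree_gt0.
Qed.

Lemma prime_zetaE (S : set (primes_of K)) (s : R) : 1 < s ->
  (\esum_(P in S) (w s P)%:E = (prime_zeta S s)%:E)%E.
Proof.
move=> s1; rewrite /prime_zeta fineK // ge0_fin_numE; last first.
  by apply: esum_ge0 => P _; rewrite lee_fin powR_ge0.
have [B B_ub] := powR_sum_bounded s1.
apply: (@le_lt_trans _ _ (((\dim {:K})%:R * B)%:E)); last exact: ltry.
apply: esum_le_finite => t ut _.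
apply: le_trans (prime_sum_le ut (fun k => powR_ge0 k%:R (- s)) B_ub).
by apply: ler_sum => P _; apply: norm_of_powR_le; lra.
Qed.

Lemma prime_zetaID (S : set (primes_of K)) (s : R) : 1 < s ->
  prime_zeta (setT : set (primes_of K)) s = prime_zeta S s + prime_zeta (~` S) s.
Proof.
move=> s1; apply/EFin_inj; rewrite EFinD -!prime_zetaE //.
rewrite (esumID S) ?setTI // => P _; by rewrite lee_fin powR_ge0.
Qed.

Lemma prime_zeta_ge0 (S : set (primes_of K)) (s : R) : 0 <= prime_zeta S s.
Proof. by apply: fine_ge0; apply: esum_ge0 => P _; rewrite lee_fin powR_ge0. Qed.

(* [N(P) ^ (s - 1) <= 2] on a finite set of primes once [s] is close to 1.    *)
Lemma prime_zeta_unbounded (A : R) :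
  exists2 d : R, 0 < d & forall s, 1 < s < 1 + d -> A < prime_zeta (setT : set (primes_of K)) s.
Proof.
have [t [ut At]] := @inv_norm_diverges R K (2 * A).
have [m m_gt0 tm] : exists2 m, (0 < m)%N & {in t, forall P, (norm_of P <= 2 ^ m)%N}.
  exists (\max_(P <- t) norm_of P).+1 => // P Pt.
  apply: leq_trans (ltnW (ltn_expl _ (ltnSn 1))).
  by rewrite ltnW // ltnS (leq_bigmax_seq (F := @norm_of K) P).
exists m%:R^-1; first by rewrite invr_gt0 ltr0n.
move=> s /andP[s1 sm]; rewrite -lte_fin -prime_zetaE //.
apply: (@lt_le_trans _ _ ((\sum_(P <- t) w s P)%:E)); last first.
  apply: esum_ge; exists [set` t]; first by split=> //; exact: finite_seq.
  by rewrite fsumEFin ?lee_fin -?fsbig_seq //; exact: finite_seq.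
rewrite lte_fin -(ltr_pM2l (ltr0Sn R 1)); apply: lt_le_trans At _.
rewrite mulr_sumr big_seq [leRHS]big_seq; apply: ler_sum => P Pt.
have NP : 0 < (norm_of P)%:R :> R by rewrite ltr0n norm_of_gt0.
rewrite /inv_norm (_ : - s = -1 - (s - 1)); last by ring.
rewrite powRB ?(lt0r_neq0 NP) ?implybT // powR_inv1 ?ler0n // mulrCA ler_peMr ?invr_ge0 ?ler0n //.
rewrite ler_pdivlMr ?powR_gt0 // mul1r.
have Pm' : (norm_of P)%:R <= 2 ^+ m :> R by rewrite -natrX ler_nat tm.
apply: (@le_trans _ _ ((2 ^+ m) `^ (s - 1))).
  by rewrite ge0_ler_powR ?nnegrE ?exprn_ge0 ?ler0n //; lra.
rewrite -powR_mulrn // -powRrM -[leRHS]powRr1 // ler_powR ?ler1n //.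
have m0 : 0 < m%:R :> R by rewrite ltr0n.
by rewrite mulrC -ler_pdivlMr // div1r; lra.
Qed.

Lemma prime_zeta_compl_bounded : exists B : R, forall s, 1 < s ->
  prime_zeta (~` degree_one_primes K) s <= B.
Proof.
have [n [a [f af]]] := power_order_exists K.
have [D D0 D_index] := power_order_index af.
have [D' D'0 [y D'E]] := power_order_deriv af.
have [B B_ub] := @powR_sum_bounded R 2 (ltr1n R 2).
pose d := `|(D * D')%R|%N.
have d0 : (0 < d)%N by rewrite absz_gt0 mulf_neq0.
pose g (k : nat) : R := k%:R `^ (- 2) + (k <= d)%:R.
have g0 k : 0 <= g k by rewrite addr_ge0 ?powR_ge0.
have gB m : \sum_(1 <= k < m) g k <= B + d%:R.
  rewrite big_split lerD //= -natr_sum ler_nat.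
  have [md|dm] := leqP m d.+1.
    rewrite (@leq_trans (\sum_(1 <= k < m) 1)%N) ?leq_sum // => [k _|]; first exact: leq_b1.
    by rewrite sum_nat_const_nat muln1 leq_subLR.
  rewrite (@big_cat_nat _ _ _ d.+1) //= ?(ltnW dm) // [X in (_ + X)%N]big_nat_cond.
  rewrite [X in (_ + X)%N]big1 ?addn0 => [|k /andP[/andP[dk _] _]]; last by rewrite leqNgt dk.
  rewrite (@leq_trans (\sum_(1 <= k < d.+1) 1)%N) ?leq_sum // => [k _|]; first exact: leq_b1.
  by rewrite sum_nat_const_nat muln1 subn1.
exists ((\dim {:K})%:R * (B + d%:R)) => s s1; rewrite -lee_fin -prime_zetaE //.
apply: esum_le_finite => t ut t_compl; apply: le_trans (prime_sum_le ut g0 gB).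
rewrite big_seq [leRHS]big_seq; apply: ler_sum => P /t_compl /= nP; rewrite /g.
have p_pr := residue_char_prime P; have p0 := prime_gt0 p_pr.
have [Pd|dP] := leqP (residue_char P) d.
  apply: (@le_trans _ _ 1); last by rewrite lerDr powR_ge0.
  by rewrite -[leRHS](powRr0 (norm_of P)%:R) ler_powR ?ler1n ?norm_of_gt0 //; lra.
have ndvd : ~~ (residue_char P %| D * D')%Z.
  by rewrite dvdzE; apply: contraL dP => /(dvdn_leq d0); rewrite -leqNgt.
have nD : ~~ (residue_char P %| D)%Z by apply: contra ndvd; exact: dvdz_mulr.
have nD' : ~~ (residue_char P %| D')%Z by apply: contra ndvd; exact: dvdz_mull.
have f2 : (2 <= inertia_degree P)%N.
  rewrite ltn_neqAle inertia_degree_gt0 andbT; apply/eqP => f1; apply: nP; split=> //.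
  exact: (unramified_of_degree_one af D_index D'E).
rewrite addr0 (@le_trans _ _ ((norm_of P)%:R^-1)) //.
  rewrite -powR_inv1 // ler_powR ?ler1n ?norm_of_gt0 //; lra.
rewrite powR_invn // lef_pV2 ?posrE ?exprn_gt0 ?ltr0n ?norm_of_gt0 //.
by rewrite -natrX ler_nat leq_pexp2l.
Qed.

Lemma degree_one_primes_density : has_density (degree_one_primes K) (1 : R).
Proof.
have [B B_ub] := prime_zeta_compl_bounded.
apply/cvgrPdist_le => e e0.
have [d d0 dP] := prime_zeta_unbounded (Num.max (B / e) 1).
near=> s.
have s1 : 1 < s by near: s; exact: nbhs_right_gt.
have sd : s < 1 + d by near: s; apply: nbhs_right_lt; rewrite ltrDl.
have := dP s; rewrite s1 sd gt_max => /(_ isT)/andP[Be one].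
have Z0 : 0 < prime_zeta (setT : set (primes_of K)) s by rewrite (lt_trans ltr01).
rewrite -{1}(divff (lt0r_neq0 Z0)) -mulrBl {1}(prime_zetaID (degree_one_primes K)) //.
rewrite addrAC subrr add0r ger0_norm ?divr_ge0 ?prime_zeta_ge0 //.
rewrite ler_pdivrMr // (le_trans (B_ub _ s1)) // mulrC -ler_pdivrMr //.
exact: ltW.
Unshelve. all: by end_near. Qed.

End Density.

(** * Characters *)

Section GroupCover.
Variables (G : groupType) (l : nat) (V : G -> Prop) (I : eqType) (H : I -> G -> Prop).
Hypothesis l_prime : prime l.
Hypotheses (V1 : V 1%g) (VM : forall x y, V x -> V y -> V (x * y)%g).
Hypothesis Vl : forall x, V x -> (x ^+ l = 1)%g.
Hypotheses (H1 : forall i, H i 1%g) (HD : forall i x y, H i x -> H i y -> H i (x * y^-1)%g).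

Let HM i x y : H i x -> H i y -> H i (x * y)%g.
Proof.
by move=> Hx Hy; rewrite -[y]invgK; apply: HD => //; rewrite -[(y^-1)%g]mul1g; exact: HD.
Qed.

Let HX i x k : H i x -> H i (x ^+ k)%g.
Proof. by move=> Hx; elim: k => [|k IHk]; [rewrite expg0 | rewrite expgS; exact: HM]. Qed.

(* If [x] lies only in [H i] and [y] outside [H i], the [l] elements [x^j y]  *)
(* avoid [H i], so two of them share another [H i'], which then contains [x]. *)
Lemma cover_subgroup (s : seq I) : (size s < l)%N ->
  (forall x, V x -> exists2 i, i \in s & H i x) ->
  exists2 i, i \in s & forall x, V x -> H i x.
Proof.
elim: s => [|i s IHs] sl cover; first by have [] := cover _ V1.
have [Hi|/existsNP[y /not_implyP[Vy nHy]]] := pselect (forall x, V x -> H i x).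
  by exists i; rewrite ?mem_head.
have [cover_s|/existsNP[x /not_implyP[Vx nHx]]] :=
    pselect (forall x, V x -> exists2 j, j \in s & H j x).
  have [j js Hj] := IHs (ltnW sl) cover_s.
  by exists j; rewrite ?inE ?js ?orbT.
have nHs j : j \in s -> ~ H j x by move=> js Hjx; apply: nHx; exists j.
have Hix : H i x.
  by have [j] := cover _ Vx; rewrite inE => /predU1P[->//|/nHs].
have VX k : V (x ^+ k)%g.
  by elim: k => [|k IHk]; [rewrite expg0 | rewrite expgS; exact: VM].
have /choice[g gP] (k : 'I_l) : exists r : 'I_(size s), H (tnth (in_tuple s) r) (x ^+ k * y)%g.
  have [j] := cover _ (VM (VX k) Vy); rewrite inE => /predU1P[->|js] Hj.
    case: nHy; rewrite -[y](mulKg (x ^+ k)%g); apply: HM Hj.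
    by rewrite -[(_^-1)%g]mul1g; apply: HD => //; exact: HX.
  have /tnthP[r jE] : j \in in_tuple s by [].
  by exists r; rewrite -jE.
have : ~~ injectiveb g.
  apply/negP => /injectiveP/leq_card; rewrite !card_ord leqNgt => /negP; apply.
  exact: ltnW.
case/injectivePn => k1 [k2 k12 gk].
wlog lt12 : k1 k2 k12 gk / (k1 < k2)%N.
  move=> wl; case: (ltngtP k1 k2) => [|lt21|/val_inj eq12]; first exact: wl.
    by apply: (wl k2 k1) => //; rewrite eq_sym.
  by rewrite eq12 eqxx in k12.
exfalso; apply: (nHs (tnth (in_tuple s) (g k1))); first exact: mem_tnth.
have Hd : H (tnth (in_tuple s) (g k1)) (x ^+ (k2 - k1))%g.
  have := gP k2; rewrite -gk => /HD/(_ (gP k1)).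
  by rewrite expgnFr ?(ltnW lt12) // invgM mulgA mulgK.
have d0 : (0 < k2 - k1)%N by rewrite subn_gt0.
have cop : coprime (k2 - k1) l.
  rewrite coprime_sym prime_coprime // gtnNdvd //.
  by rewrite (leq_ltn_trans (leq_subr _ _)).
have [u v uv _] := egcdnP l d0.
have -> : x = ((x ^+ (k2 - k1)) ^+ u)%g.
  rewrite -expgnA mulnC uv (eqP cop) expgnDr expg1 mulnC expgnA Vl //.
  by rewrite expg1n mul1g.
exact: HX.
Qed.

End GroupCover.

Section Characters.
Variables (R : realType) (K : fieldExtType rat) (iota : {rmorphism K -> algC}).
Implicit Types (chi theta : dirichlet iota R) (P : primes_of K).

Lemma unramified_atD chi theta P :
  unramified_at chi P -> unramified_at theta P -> unramified_at (chi * theta^-1)%g P.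
Proof.
move=> uc ut Q s QP sQ; rewrite -[LHS]/(chi s * (theta s)^-1).
by rewrite (uc Q) // (ut Q) // invr1 mulr1.
Qed.

Lemma char_atE chi P : unramified_at chi P -> char_at chi P = chi (Frob iota P).
Proof. by move=> uc; rewrite /char_at asboolT. Qed.

Lemma char_at_neq0 chi P : unramified_at chi P <-> char_at chi P != 0.
Proof.
rewrite /char_at; split=> [uc|].
  by rewrite asboolT //; case: (dirichletP chi).
by case: asboolP => //; rewrite eqxx.
Qed.

Lemma char_at1 P : char_at (1%g : dirichlet iota R) P = 1.
Proof. exact: char_atE. Qed.

Lemma char_atD chi theta P : unramified_at chi P -> unramified_at theta P ->
  char_at (chi * theta^-1)%g P = char_at chi P / char_at theta P.
Proof. by move=> uc ut; rewrite !char_atE //; exact: unramified_atD. Qed.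

Lemma char_exp chi k s : (chi ^+ k)%g s = chi s ^+ k.
Proof.
elim: k => [|k IHk]; first by rewrite expg0.
by rewrite expgS exprS -IHk.
Qed.

Lemma dirichlet_gen_exp l (chi : dirichlet_gen iota R l) : (chi ^+ l = 1)%g.
Proof.
apply: val_inj; rewrite gmulfXn gmulf1 /=.
have /asboolP := valP chi.
pose H : {pred dirichlet iota R} := fun theta => `[< forall s, theta s ^+ l = 1 >].
move/(_ H)=> chiH; have /asboolP chil : gen_char chi \in H.
  apply: chiH => [|theta [_ thetal _]]; last first.
    by apply/asboolP => s; rewrite -char_exp thetal.
  split=> [|c t /asboolP cH /asboolP tH]; apply/asboolP => s.
    by rewrite -[X in X ^+ _]/1 expr1n.
  by rewrite -[X in X ^+ _]/(c s * (t s)^-1) exprMn exprVn cH tH invr1 mulr1.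
by apply/val_inj/funext => s; exact: etrans (char_exp _ _ _) (chil s).
Qed.

Lemma local_factor_eq0 chi p (x : R[i]) : prime p ->
  (local_factor chi p).[x] = 0 <-> exists2 P : primes_of K, primes_above p P &
    char_at chi P * x ^+ inertia_degree P = 1.
Proof.
move=> p_pr; have fin := finite_primes_above K p_pr.
have factor P : (1 - char_at chi P *: 'X^(inertia_degree P)).[x] =
   1 - char_at chi P * x ^+ inertia_degree P by rewrite !hornerE.
rewrite /local_factor fsbig_finite //= horner_prod; split.
  move/eqP; rewrite prodf_seq_eq0 => /hasP[P Pp]; rewrite factor subr_eq0 => /eqP one.
  by exists P => //; move: Pp; rewrite in_fset_set // inE.
case=> P Pp one; apply/eqP; rewrite prodf_seq_eq0; apply/hasP; exists P.
  by rewrite in_fset_set // inE.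
by rewrite factor one subrr eqxx.
Qed.

End Characters.

Theorem theorem5p2 (R : realType) (K K' : fieldExtType rat)
    (iota : {rmorphism K -> algC}) (iota' : {rmorphism K' -> algC})
    (l : nat) (l_prime : prime l) (l_gt : (\dim {: K'}%VS < l)%N)
    (psi : {multiplicative dirichlet_gen iota R l -> dirichlet_gen iota' R l}) :
  hom_Lseries psi -> hom_primes_density psi.
Proof.
move=> psiL.
have main (P : degree_one_primes K) : exists P' : primes_of K',
    residue_char P' = residue_char (val P) /\
    forall chi : dirichlet_gen iota R l, unramified_at chi (val P) ->
      char_at (psi chi) P' = char_at chi (val P) ^+ inertia_degree P'.
  case: P => P /= /set_mem [_ f1]; set p := residue_char P.
  have p_pr : prime p := residue_char_prime P.
  have fin := finite_primes_above K' p_pr.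
  pose H (P' : primes_of K') (chi : dirichlet_gen iota R l) := unramified_at chi P /\
    char_at (psi chi) P' = char_at chi P ^+ inertia_degree P'.
  pose s : seq (primes_of K') := fset_set (primes_above p).
  have sP P' : P' \in s <-> residue_char P' = p.
    by rewrite -(primes_aboveE P' p_pr) /s in_fset_set // inE.
  have genD (G : fieldExtType rat) (j : {rmorphism G -> algC}) (c t : dirichlet_gen j R l) :
      gen_char (c * t^-1)%g = (gen_char c * (gen_char t)^-1)%g.
    pose v : {multiplicative dirichlet_gen j R l -> dirichlet j R} := val.
    transitivity (gen_char c * gen_char t^-1)%g; first exact: (@gmulfM _ _ v c _).
    by congr (_ * _)%g; exact: (@gmulfV _ _ v t).
  have psi1 : psi 1%g = 1%g.
    by rewrite -[LHS](mulKg (psi 1%g)) -gmulfM mulg1 mulVg.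
  have psiD (c t : dirichlet_gen iota R l) : psi (c * t^-1)%g = (psi c * (psi t)^-1)%g.
    by rewrite -[LHS](mulgK (psi t)) -gmulfM mulgKV.
  have gen1 (G : fieldExtType rat) (j : {rmorphism G -> algC}) :
      gen_char (1%g : dirichlet_gen j R l) = 1%g.
    pose v : {multiplicative dirichlet_gen j R l -> dirichlet j R} := val.
    exact: (@gmulf1 _ _ v).
  have [P' /sP P'p HP'] : exists2 P', P' \in s &
      forall chi : dirichlet_gen iota R l, unramified_at chi P -> H P' chi.
    apply: (cover_subgroup (V := fun chi : dirichlet_gen iota R l => unramified_at chi P)
              l_prime).
    - by rewrite gen1.
    - move=> c t uc ut; rewrite -[t]invgK genD; apply: unramified_atD => //.
      by rewrite -[(t^-1)%g]mul1g genD gen1; exact: unramified_atD.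
    - by move=> c _; exact: dirichlet_gen_exp.
    - by move=> P'; rewrite /H psi1 !gen1 !char_at1 expr1n.
    - move=> P' c t [uc Hc] [ut Ht].
      have c0 : unramified_at (psi c) P' by apply/char_at_neq0; rewrite Hc expf_neq0 // -char_at_neq0.
      have t0 : unramified_at (psi t) P' by apply/char_at_neq0; rewrite Ht expf_neq0 // -char_at_neq0.
      split; first by rewrite genD; exact: unramified_atD.
      by rewrite psiD !genD !char_atD // Hc Ht exprMn exprVn.
    - apply: leq_ltn_trans l_gt; apply: (@size_primes_above _ p); first exact: fset_uniq.
      by move=> P' /sP.
    move=> chi uc; have c0 : char_at chi P != 0 by apply/char_at_neq0.
    have chiP : (local_factor chi p).[(char_at chi P)^-1] = 0.
      apply/local_factor_eq0 => //; exists P; first exact/primes_aboveE.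
      by rewrite f1 expr1 mulfV.
    have /dvdpP[q qE] := psiL p p_pr chi.
    have : (local_factor (psi chi) p).[(char_at chi P)^-1] = 0.
      by rewrite qE hornerM chiP mulr0.
    case/(local_factor_eq0 _ _ p_pr) => P' P'p one; exists P'.
      by apply/sP/primes_aboveE.
    split=> //; apply: (mulIf (expf_neq0 (inertia_degree P') (invr_neq0 c0))).
    by rewrite one exprVn mulfV // expf_neq0.
  by exists P'; split=> // chi /HP'[].
have /choice[phi phiP] := main.
exists (degree_one_primes K), phi; split=> //; first exact: degree_one_primes_density.
move=> P _; have [P'p P'chi] := phiP P; split=> // n.
by rewrite !primes_of_int P'p.
Qed.
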